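(* Let $d\ge1$, let $\mathcal J$ be a finite index set, and let $(T,\{M^{[j]}\}_{j\in\mathcal J})$ and $(T',\{M'^{[j]}\}_{j\in\mathcal J})$ be two generic translation-invariant cMPS data of bond dimension $d$, both with finite $p$-number at most $p$. Suppose that $\mathcal C^{(\ell)}_{\mathbf j}(\boldsymbol\tau)=\mathcal C'^{(\ell)}_{\mathbf j}(\boldsymbol\tau)$ for all $1\le\ell\le2p-1$, all $\mathbf j\in\mathcal J^\ell$ and all $\boldsymbol\tau\in[0,\infty)^{\ell-1}$. Then $\mathcal C^{(N)}_{\mathbf j}(\boldsymbol\tau)=\mathcal C'^{(N)}_{\mathbf j}(\boldsymbol\tau)$ for all $N\ge1$, $\mathbf j\in\mathcal J^N$, $\boldsymbol\tau\in[0,\infty)^{N-1}$. In other words, a generic translation-invariant cMPS with $p$-number $p$ is completely characterized by its correlation functions of order at most $2p-1$.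
   Context: Generic translation-invariant cMPS data of bond dimension $d$: for matrices $Q,R\in\mathbb C^{d\times d}$, the Liouvillian $T=Q^*\otimes\mathbb1+\mathbb1\otimes Q+R^*\otimes R\in\mathbb C^{d^2\times d^2}$ has $d^2$ pairwise distinct eigenvalues $\lambda_1,\dots,\lambda_{d^2}$ with $\lambda_1=0$ and $\mathrm{Re}\,\lambda_k<0$ for $k\ge2$; the matrices $M^{[j]}$ are each one of $R^*\otimes\mathbb1$, $\mathbb1\otimes R$, $R^*\otimes R$. Let $e^{T\infty}=\lim_{L\to\infty}e^{TL}$. The correlation function of order $N$ (a normal-ordered correlator of the fields $\Psi,\Psi^\dagger$ at points $0=x_1<\dots<x_N$, $\tau_i=x_{i+1}-x_i$) is $\mathcal C^{(N)}_{\mathbf j}(\boldsymbol\tau)=\mathrm{Tr}\big(M^{[j_N]}e^{T\tau_{N-1}}M^{[j_{N-1}]}\cdots e^{T\tau_1}M^{[j_1]}e^{T\infty}\big)$. Its Laplace transform $\mathcal L^{(N)}_{\mathbf j}(\mathbf s)=\int_{[0,\infty)^{N-1}}e^{-\mathbf s\cdot\boldsymbol\tau}\mathcal C^{(N)}_{\mathbf j}(\boldsymbol\tau)d\boldsymbol\tau$ converges for $\mathrm{Re}\,s_i>0$ and extends to a rational function with poles only along the hyperplanes $\{s_i=\lambda_k\}$. $p$-number: the smallest integer $p$ such that there exist $N\le p$, $\mathbf j\in\mathcal J^N$ and $i$ for which $\mathcal L^{(N)}_{\mathbf j}$ has $d^2$ distinct poles in the variable $s_i$, i.e. a pole along $\{s_i=\lambda_k\}$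 for every $k=1,\dots,d^2$; infinite if no such $p$ exists. *)

(* Defs.v *)
From Stdlib Require Import Reals Lra Lia List ClassicalEpsilon Arith Factorial.
Import ListNotations.
Open Scope R_scope.

Record C : Type := mkC { re : R ; im : R }.
Definition C0 : C := mkC 0 0.
Definition C1 : C := mkC 1 0.
Definition Cadd (z w : C) : C := mkC (re z + re w) (im z + im w).
Definition Copp (z : C) : C := mkC (- re z) (- im z).
Definition Csub (z w : C) : C := Cadd z (Copp w).
Definition Cmul (z w : C) : C :=
  mkC (re z * re w - im z * im w) (re z * im w + im z * re w).
Definition Cconj (z : C) : C := mkC (re z) (- im z).
Definition Cnorm (z : C) : R := sqrt (re z * re z + im z * im z).
Definition Cinv (z : C) : C :=
  let n2 := re z * re z + im z * im z in mkC (re z / n2) (- im z / n2).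
Definition Cdiv (z w : C) : C := Cmul z (Cinv w).
Definition RtoC (x : R) : C := mkC x 0.
Definition Cexp (z : C) : C := mkC (exp (re z) * cos (im z)) (exp (re z) * sin (im z)).

Fixpoint Csum (n : nat) (f : nat -> C) : C :=
  match n with O => C0 | S m => Cadd (Csum m f) (f m) end.

Fixpoint Peval (l : list C) (z : C) : C :=
  match l with [] => C0 | a :: l' => Cadd a (Cmul z (Peval l' z)) end.

Definition C_inhabited : inhabited C := inhabits C0.
(* limit of a complex sequence (junk C0-ish value if it does not exist) *)
Definition Clim (u : nat -> C) : C :=
  epsilon C_inhabited (fun l => Un_cv (fun k => re (u k)) (re l) /\
                                Un_cv (fun k => im (u k)) (im l)).
Definition Clim_inf (f : R -> C) : C :=
  epsilon C_inhabited (fun l => forall eps, eps > 0 ->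
     exists L0, forall L, L >= L0 -> Cnorm (Csub (f L) l) < eps).

Definition Mat := nat -> nat -> C.
Definition Mid : Mat := fun i j => if Nat.eqb i j then C1 else C0.
Definition Mzero : Mat := fun _ _ => C0.
Definition Madd (A B : Mat) : Mat := fun i j => Cadd (A i j) (B i j).
Definition Mmul (n : nat) (A B : Mat) : Mat :=
  fun i j => Csum n (fun k => Cmul (A i k) (B k j)).
Definition Mscal (c : C) (A : Mat) : Mat := fun i j => Cmul c (A i j).
Definition Mconj (A : Mat) : Mat := fun i j => Cconj (A i j).
Fixpoint Mpow (n : nat) (A : Mat) (m : nat) : Mat :=
  match m with O => Mid | S m' => Mmul n A (Mpow n A m') end.
Definition Mtrace (n : nat) (A : Mat) : C := Csum n (fun i => A i i).
Definition kron (d : nat) (A B : Mat) : Mat :=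
  fun i j => Cmul (A (Nat.div i d) (Nat.div j d)) (B (Nat.modulo i d) (Nat.modulo j d)).

Definition Mexp (n : nat) (A : Mat) (t : R) : Mat :=
  fun i j => Clim (fun K => Csum (S K) (fun m =>
     Cmul (RtoC (t ^ m / INR (fact m))) (Mpow n A m i j))).
Definition Mexp_inf (n : nat) (A : Mat) : Mat :=
  fun i j => Clim_inf (fun L => Mexp n A L i j).

Definition eigenvalue (n : nat) (A : Mat) (mu : C) : Prop :=
  exists v : nat -> C, (exists i, (i < n)%nat /\ v i <> C0) /\
    forall i, (i < n)%nat -> Csum n (fun k => Cmul (A i k) (v k)) = Cmul mu (v i).

Inductive Kind : Type := KPsiDag | KPsi | KDens.

Definition Liouv (d : nat) (Qm Rm : Mat) : Mat :=
  Madd (Madd (kron d (Mconj Qm) Mid) (kron d Mid Qm)) (kron d (Mconj Rm) Rm).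

Definition Mop (d : nat) (Rm : Mat) (k : Kind) : Mat :=
  match k with
  | KPsiDag => kron d (Mconj Rm) Mid
  | KPsi => kron d Mid Rm
  | KDens => kron d (Mconj Rm) Rm
  end.

Definition generic (d : nat) (Qm Rm : Mat) : Prop :=
  exists lam : nat -> C,
    (forall k, (k < d * d)%nat -> eigenvalue (d * d) (Liouv d Qm Rm) (lam k)) /\
    (forall k k', (k < d * d)%nat -> (k' < d * d)%nat -> lam k = lam k' -> k = k') /\
    lam O = C0 /\
    (forall k, (1 <= k < d * d)%nat -> re (lam k) < 0).

Section Corr.
Variables (d : nat) (J : Type) (kind : J -> Kind) (Qm Rm : Mat).
Let n := (d * d)%nat.
Let T := Liouv d Qm Rm.
Let M (j : J) := Mop d Rm (kind j).

Fixpoint chain (js : list J) (ts : list R) : Mat :=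
  match js, ts with
  | j :: ((_ :: _) as js'), t :: ts' => Mmul n (chain js' ts') (Mmul n (Mexp n T t) (M j))
  | j :: _, _ => M j
  | [], _ => Mid
  end.

Definition corr (js : list J) (ts : list R) : C :=
  Mtrace n (Mmul n (chain js ts) (Mexp_inf n T)).
End Corr.

Definition is_RIntC (f : R -> C) (a b : R) (w : C) : Prop :=
  (exists pr : Riemann_integrable (fun t => re (f t)) a b, RiemannInt pr = re w) /\
  (exists pr : Riemann_integrable (fun t => im (f t)) a b, RiemannInt pr = im w).

Definition improper_int (f : R -> C) (v : C) : Prop :=
  forall eps, eps > 0 -> exists A0, forall A, A >= A0 ->
    exists w, is_RIntC f 0 A w /\ Cnorm (Csub w v) < eps.

Fixpoint LapRel (g : list R -> C) (s : list C) (v : C) : Prop :=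
  match s with
  | [] => v = g []
  | s1 :: s' => exists h : R -> C,
      (forall t, 0 <= t -> LapRel (fun ts => g (t :: ts)) s' (h t)) /\
      improper_int (fun t => Cmul (Cexp (Copp (Cmul s1 (RtoC t)))) (h t)) v
  end.

Fixpoint replace_nth {A : Type} (l : list A) (i : nat) (x : A) : list A :=
  match l, i with
  | [], _ => []
  | _ :: l', O => x :: l'
  | a :: l', S i' => a :: replace_nth l' i' x
  end.

(* The (rationally extended) Laplace transform L^{(N)}_js has a pole along the
   hyperplane {s_i = mu}: on some slice (other variables fixed with Re > 0),
   the Laplace transform in s_i coincides for Re s_i > 0 with a rational
   function P/Q which is unbounded near mu. *)
Definition has_pole (d : nat) (J : Type) (kind : J -> Kind) (Qm Rm : Mat)
    (js : list J) (i : nat) (mu : C) : Prop :=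
  exists s : list C, length s = (length js - 1)%nat /\
    (forall z, In z s -> re z > 0) /\
    exists P D : list C,
      (forall z, re z > 0 -> Peval D z <> C0 /\
          LapRel (corr d J kind Qm Rm js) (replace_nth s i z) (Cdiv (Peval P z) (Peval D z))) /\
      (forall B delta, delta > 0 -> exists z,
          0 < Cnorm (Csub z mu) < delta /\ Peval D z <> C0 /\
          Cnorm (Cdiv (Peval P z) (Peval D z)) > B).

Definition pnum_le (d : nat) (J : Type) (kind : J -> Kind) (Qm Rm : Mat) (q : nat) : Prop :=
  exists N js i, (N <= q)%nat /\ length js = N /\ (i < N - 1)%nat /\
    forall mu, eigenvalue (d * d) (Liouv d Qm Rm) mu -> has_pole d J kind Qm Rm js i mu.

Definition pnumber (d : nat) (J : Type) (kind : J -> Kind) (Qm Rm : Mat) (p : nat) : Prop :=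
  pnum_le d J kind Qm Rm p /\ forall q, pnum_le d J kind Qm Rm q -> (p <= q)%nat.

(* Main.v *)
(* In the eigenbasis of the Liouvillian T a correlation function is an exponential
   sum, and its Laplace transform is a sum of products of coefficients of the
   matrices M^[j] in that basis and of factors 1/(s_i - lambda_k). A word with a pole
   along every {s_i = lambda_k} splits into a right part U_k and a left part X_k whose
   products U_k X_k are not identically zero for any k. Equality of the correlators
   of that word forces the two spectra to coincide and U_k X_k = U'_k X'_k. Inserting
   one more letter j between the two parts gives U_k m^j_lk X_l = U'_k m'^j_lk X'_l by
   uniqueness of partial fractions, so the coefficients m^j and m'^j are conjugate by
   the diagonal matrix (U'_k / U_k)_k, and all correlators agree. *)
From Stdlib Require Import Reals Lra Lia List Arith.
From Stdlib Require Import Classical ClassicalEpsilon FunctionalExtensionality.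
From Coquelicot Require Import Coquelicot.
Require Import Defs.
Import ListNotations.
Open Scope R_scope.

(* Poles along different hyperplanes may be visible only on different slices of the remaining
   variables, so there need not be one slice on which all U_k X_k are nonzero. A slice is therefore
   chosen for each k separately. The inserted letter makes this harmless: the variables on its two
   sides are independent, so the right part may use the slice of k and the left part that of l.

   The longest word compared has one letter more than the word with the poles. That word has a time
   variable, hence at least two letters, so p is at least 2 and p + 1 <= 2p - 1.

   Eigenvectors are determined only up to a scalar each. The diagonal matrix is exactly this
   freedom, so nothing stronger than a diagonal conjugacy can be expected.

   Transforms are known only for positive real parts. Instead of analytic continuation, denominators
   are cleared and polynomial identities are extended from the half-plane to the whole plane. *)
Declare Scope Cx_scope.
Delimit Scope Cx_scope with Cx.
Bind Scope Cx_scope with C.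
Infix "+" := Cadd : Cx_scope.
Infix "-" := Csub : Cx_scope.
Infix "*" := Cmul : Cx_scope.
Infix "/" := Cdiv : Cx_scope.
Notation "- z" := (Copp z) : Cx_scope.

(** * The field of complex numbers *)

Lemma C_ext (z w : C) : re z = re w -> im z = im w -> z = w.
Proof. destruct z, w; simpl; congruence. Qed.

Lemma C_normsq_neq0 (z : C) : z <> C0 -> re z * re z + im z * im z <> 0.
Proof.
  intros Hz H; apply Hz, C_ext; simpl; nra.
Qed.

Lemma Cx_field_theory :
  field_theory C0 C1 Cadd Cmul Csub Copp Cdiv Cinv (@eq C).
Proof.
  constructor; [constructor | | | ].
  1-9: intros; apply C_ext; simpl; ring.
  - intros H; apply (f_equal re) in H; simpl in H; lra.
  - reflexivity.
  - intros z Hz; apply C_normsq_neq0 in Hz; apply C_ext; simpl; field; exact Hz.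
Qed.

Add Field Cx_field : Cx_field_theory.

Lemma C1_neq_0 : C1 <> C0.
Proof. exact (F_1_neq_0 Cx_field_theory). Qed.

Lemma Cmul_integral (z w : C) : (z * w)%Cx = C0 -> z = C0 \/ w = C0.
Proof.
  intros H; destruct (classic (z = C0)) as [|Hz]; [now left|right].
  replace w with (Cinv z * (z * w))%Cx by (field; exact Hz).
  rewrite H; ring.
Qed.

Lemma Cmul_cancel_l (z w w' : C) : z <> C0 -> (z * w = z * w')%Cx -> w = w'.
Proof.
  intros Hz H.
  replace w with (Cinv z * (z * w))%Cx by (field; exact Hz).
  rewrite H; field; exact Hz.
Qed.

Lemma Csub_neq0 (z w : C) : z <> w -> (z - w)%Cx <> C0.
Proof.
  intros H E; apply H.
  replace z with ((z - w) + w)%Cx by ring.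
  rewrite E; ring.
Qed.

Lemma Csub_neq0_re (z w : C) : re w < re z -> (z - w)%Cx <> C0.
Proof.
  intros H; apply Csub_neq0; intros ->; lra.
Qed.

(** Imports the triangle inequality and multiplicativity from Coquelicot's modulus, whose complex
    numbers are pairs of reals. *)
Lemma Cnorm_Cmod (z : C) : Cnorm z = Cmod (re z, im z).
Proof. unfold Cnorm, Cmod; simpl; f_equal; ring. Qed.

Lemma Cnorm_add (z w : C) : Cnorm (z + w) <= Cnorm z + Cnorm w.
Proof. rewrite !Cnorm_Cmod; apply (Cmod_triangle (re z, im z) (re w, im w)). Qed.

Lemma Cnorm_mul (z w : C) : Cnorm (z * w) = Cnorm z * Cnorm w.
Proof. rewrite !Cnorm_Cmod; apply (Cmod_mult (re z, im z) (re w, im w)). Qed.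

Lemma Cnorm_opp (z : C) : Cnorm (- z) = Cnorm z.
Proof. unfold Cnorm; simpl; f_equal; ring. Qed.

Lemma Cnorm_ge0 (z : C) : 0 <= Cnorm z.
Proof. apply sqrt_pos. Qed.

Lemma Cnorm_C0 : Cnorm C0 = 0.
Proof. unfold Cnorm; simpl; rewrite Rmult_0_l, Rplus_0_l; apply sqrt_0. Qed.

Lemma Cnorm_C1 : Cnorm C1 = 1.
Proof. unfold Cnorm; simpl; rewrite Rmult_1_l, Rmult_0_l, Rplus_0_r; apply sqrt_1. Qed.

Lemma Cnorm_eq0 (z : C) : Cnorm z = 0 -> z = C0.
Proof.
  intros H; apply sqrt_eq_0 in H; [|nra].
  apply C_ext; simpl; nra.
Qed.

Lemma Cnorm_gt0 (z : C) : z <> C0 -> 0 < Cnorm z.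
Proof.
  intros Hz; destruct (Cnorm_ge0 z) as [|E]; [assumption|].
  now contradict Hz; apply Cnorm_eq0.
Qed.

Lemma Cnorm_Cexp (z : C) : Cnorm (Cexp z) = exp (re z).
Proof.
  unfold Cnorm; simpl.
  replace (_ + _) with (exp (re z) * exp (re z)).
  - apply sqrt_square, Rlt_le, exp_pos.
  - generalize (sin2_cos2 (im z)); unfold Rsqr; intros H.
    transitivity (exp (re z) * exp (re z) * 1); [ring|].
    rewrite <- H; ring.
Qed.

Lemma Cexp_add (z w : C) : Cexp (z + w) = (Cexp z * Cexp w)%Cx.
Proof.
  apply C_ext; simpl; rewrite exp_plus, ?cos_plus, ?sin_plus; ring.
Qed.

(** * Finite sums *)

Lemma Csum_ext (n : nat) (f g : nat -> C) :
  (forall k, (k < n)%nat -> f k = g k) -> Csum n f = Csum n g.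
Proof.
  induction n as [|n IH]; intros H; simpl; [reflexivity|].
  rewrite IH, H; auto.
Qed.

Lemma Csum_add (n : nat) (f g : nat -> C) :
  Csum n (fun k => f k + g k)%Cx = (Csum n f + Csum n g)%Cx.
Proof. induction n as [|n IH]; simpl; [|rewrite IH]; ring. Qed.

Lemma Csum_scal (n : nat) (c : C) (f : nat -> C) :
  Csum n (fun k => c * f k)%Cx = (c * Csum n f)%Cx.
Proof. induction n as [|n IH]; simpl; [|rewrite IH]; ring. Qed.

Lemma Csum_scal_r (n : nat) (c : C) (f : nat -> C) :
  Csum n (fun k => f k * c)%Cx = (Csum n f * c)%Cx.
Proof. induction n as [|n IH]; simpl; [|rewrite IH]; ring. Qed.

Lemma Csum_sub (n : nat) (f g : nat -> C) :
  Csum n (fun k => f k - g k)%Cx = (Csum n f - Csum n g)%Cx.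
Proof. induction n as [|n IH]; simpl; [|rewrite IH]; ring. Qed.

Lemma Csum_eq0 (n : nat) (f : nat -> C) :
  (forall k, (k < n)%nat -> f k = C0) -> Csum n f = C0.
Proof.
  induction n as [|n IH]; intros H; simpl; [reflexivity|].
  rewrite IH, H by auto; ring.
Qed.

Lemma Csum_swap (n m : nat) (f : nat -> nat -> C) :
  Csum n (fun i => Csum m (fun j => f i j)) =
  Csum m (fun j => Csum n (fun i => f i j)).
Proof.
  induction n as [|n IH]; simpl.
  - symmetry; apply Csum_eq0; reflexivity.
  - rewrite IH, <- Csum_add; reflexivity.
Qed.

Definition unitv (k i : nat) : C := if Nat.eqb i k then C1 else C0.

Lemma Csum_unitv (n k : nat) (f : nat -> C) :
  (k < n)%nat -> Csum n (fun i => f i * unitv k i)%Cx = f k.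
Proof.
  unfold unitv; induction n as [|n IH]; intros H; simpl; [lia|].
  destruct (Nat.eqb_spec n k) as [->|Hn].
  - rewrite Csum_eq0; [ring|].
    intros i Hi; destruct (Nat.eqb_spec i k); [lia|ring].
  - rewrite IH by lia; ring.
Qed.

Lemma Csum_Mid_l (n i : nat) (f : nat -> C) :
  (i < n)%nat -> Csum n (fun k => Mid i k * f k)%Cx = f i.
Proof.
  intros H; rewrite <- (Csum_unitv n i f H); apply Csum_ext; intros k _.
  unfold Mid, unitv; rewrite Nat.eqb_sym; ring.
Qed.

(** Serves Gaussian elimination: [k0] is the pivot column, and the renumbering enumerates the
    remaining columns. *)
Lemma Csum_remove (n k0 : nat) (f : nat -> C) :
  (k0 <= n)%nat ->
  Csum (S n) f = (f k0 + Csum n (fun k => f (if Nat.ltb k k0 then k else S k)))%Cx.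
Proof.
  intros H; induction n as [|n IH].
  - replace k0 with 0%nat by lia; simpl; ring.
  - destruct (Nat.eq_dec k0 (S n)) as [->|Hk].
    + simpl Csum at 1.
      rewrite (Csum_ext (S n) (fun k => f (if Nat.ltb k (S n) then k else S k)) f).
      * simpl; ring.
      * intros k Hk; destruct (Nat.ltb_spec k (S n)); [reflexivity|lia].
    + change (Csum (S (S n)) f) with (Csum (S n) f + f (S n))%Cx.
      rewrite IH by lia.
      simpl Csum at 2; destruct (Nat.ltb_spec n k0); [lia|ring].
Qed.

(** * Polynomials *)

(** Synthetic division by [X - w]: the quotient coefficients are the Horner values of the successive
    tails. *)
Fixpoint Psynth (l : list C) (w : C) : list C :=
  match l with [] => [] | _ :: l' => Peval l' w :: Psynth l' w end.

Lemma Psynth_spec (l : list C) (z w : C) :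
  Peval l z = (Peval l w + (z - w) * Peval (Psynth l w) z)%Cx.
Proof.
  induction l as [|a l IH]; simpl; [ring|].
  set (q := Peval (Psynth l w) z) in *.
  rewrite IH; ring.
Qed.

Lemma Psynth_length (l : list C) (w : C) : length (Psynth l w) = length l.
Proof. induction l; simpl; congruence. Qed.

(* The last coefficient produced by [Psynth] is the junk value [Peval [] w = 0];
   the quotient proper has one coefficient less than [l]. *)
Lemma Psynth_removelast (l : list C) (w z : C) :
  Peval (removelast (Psynth l w)) z = Peval (Psynth l w) z.
Proof.
  induction l as [|a [|b l] IH]; simpl in *; [reflexivity|ring|].
  rewrite IH; reflexivity.
Qed.

Lemma removelast_length {A : Type} (l : list A) :
  length (removelast l) = (length l - 1)%nat.
Proof.
  induction l as [|a [|b l] IH]; simpl in *; [reflexivity|reflexivity|].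
  rewrite IH; lia.
Qed.

(** Induction on the roots: dividing by [X - w] shortens the list by one, and the quotient still
    vanishes at the other roots. A list of n coefficients has degree below n, so n distinct roots
    suffice. *)
Lemma Peval_many_roots (l roots : list C) :
  NoDup roots -> (length l <= length roots)%nat ->
  (forall w, In w roots -> Peval l w = C0) -> forall z, Peval l z = C0.
Proof.
  revert l; induction roots as [|w roots IH]; intros l Hnd Hlen Hr z.
  - destruct l; [reflexivity|simpl in Hlen; lia].
  - inversion Hnd as [|? ? Hw Hnd']; subst.
    assert (Hq : forall u, Peval (removelast (Psynth l w)) u = C0).
    { apply IH; [assumption| |].
      - rewrite removelast_length, Psynth_length; simpl in Hlen; lia.
      - intros u Hu; rewrite Psynth_removelast.
        apply (Cmul_cancel_l (u - w)).
        + apply Csub_neq0; intros ->; contradiction.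
        + generalize (Psynth_spec l u w).
          rewrite (Hr u), (Hr w) by (simpl; auto); intros E.
          transitivity (C0 + (u - w) * Peval (Psynth l w) u)%Cx; [ring|].
          rewrite <- E; ring. }
    rewrite (Psynth_spec l z w), (Hr w) by (simpl; auto).
    rewrite <- Psynth_removelast, Hq; ring.
Qed.

(** Stands in for analytic continuation: the half-plane contains 1, 2, 3, ..., more roots than a
    nonzero polynomial can have. *)
Lemma Peval_halfplane_eq0 (l : list C) :
  (forall z, re z > 0 -> Peval l z = C0) -> forall z, Peval l z = C0.
Proof.
  intros H.
  apply (Peval_many_roots l (map (fun k => RtoC (INR (S k))) (seq 0 (length l)))).
  - apply NoDup_map_NoDup_ForallPairs; [|apply seq_NoDup].
    intros i j _ _ E; apply (f_equal re) in E; cbn [re RtoC] in E.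
    apply INR_eq in E; lia.
  - rewrite length_map, length_seq; lia.
  - intros w Hw; apply in_map_iff in Hw; destruct Hw as [k [<- _]].
    apply H; cbn [re RtoC]; apply Rlt_gt, lt_0_INR; lia.
Qed.

Lemma Peval_bounded (l : list C) (w : C) :
  exists B, 0 <= B /\ forall z, Cnorm (z - w) <= 1 -> Cnorm (Peval l z) <= B.
Proof.
  induction l as [|a l [B [HB IH]]].
  - exists 0; split; [lra|]; intros z _; simpl; rewrite Cnorm_C0; lra.
  - exists (Cnorm a + (1 + Cnorm w) * B); split.
    + generalize (Cnorm_ge0 a) (Cnorm_ge0 w); nra.
    + intros z Hz; simpl.
      eapply Rle_trans; [apply Cnorm_add|apply Rplus_le_compat_l].
      rewrite Cnorm_mul; apply Rmult_le_compat; try apply Cnorm_ge0; [|now apply IH].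
      replace z with ((z - w) + w)%Cx by ring.
      eapply Rle_trans; [apply Cnorm_add|lra].
Qed.

(** Being polynomial is made a property of functions, so that sums and products are formed
    pointwise, without arithmetic on coefficient lists. *)
Definition polyfun (f : C -> C) : Prop := exists l, forall z, f z = Peval l z.

Lemma polyfun_Peval (l : list C) : polyfun (Peval l).
Proof. now exists l. Qed.

Lemma polyfun_const (c : C) : polyfun (fun _ => c).
Proof. exists [c]; intros z; simpl; ring. Qed.

Lemma polyfun_id : polyfun (fun z => z).
Proof. exists [C0; C1]; intros z; simpl; ring. Qed.

Lemma polyfun_add (f g : C -> C) :
  polyfun f -> polyfun g -> polyfun (fun z => f z + g z)%Cx.
Proof.
  intros [l Hl] [m Hm].
  assert (H : exists k, forall z, Peval k z = (Peval l z + Peval m z)%Cx).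
  { clear f g Hl Hm; revert m; induction l as [|a l IH]; intros m.
    - exists m; intros z; simpl; ring.
    - destruct m as [|b m].
      + exists (a :: l); intros z; simpl; ring.
      + destruct (IH m) as [k Hk]; exists ((a + b)%Cx :: k).
        intros z; simpl; rewrite Hk; ring. }
  destruct H as [k Hk]; exists k; intros z; now rewrite Hk, Hl, Hm.
Qed.

Lemma polyfun_scal (c : C) (f : C -> C) :
  polyfun f -> polyfun (fun z => c * f z)%Cx.
Proof.
  intros [l Hl]; exists (map (Cmul c) l); intros z; rewrite Hl; clear Hl.
  induction l as [|a l IH]; simpl; [ring|rewrite <- IH; ring].
Qed.

Lemma polyfun_mul (f g : C -> C) :
  polyfun f -> polyfun g -> polyfun (fun z => f z * g z)%Cx.
Proof.
  intros [l Hl] Hg.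
  assert (H : polyfun (fun z => Peval l z * g z)%Cx).
  { clear f Hl; induction l as [|a l [k Hk]].
    - exists []; intros z; simpl; ring.
    - destruct (polyfun_add (fun z => a * g z)%Cx (Peval (C0 :: k))) as [q Hq].
      + now apply polyfun_scal.
      + apply polyfun_Peval.
      + exists q; intros z; rewrite <- Hq; simpl; rewrite <- Hk; ring. }
  destruct H as [k Hk]; exists k; intros z; now rewrite Hl.
Qed.

Lemma polyfun_sub (f g : C -> C) :
  polyfun f -> polyfun g -> polyfun (fun z => f z - g z)%Cx.
Proof.
  intros Hf Hg.
  destruct (polyfun_add f (fun z => (- C1) * g z)%Cx Hf (polyfun_scal _ _ Hg)) as [l Hl].
  exists l; intros z; rewrite <- Hl; ring.
Qed.

Lemma polyfun_halfplane_eq (f g : C -> C) :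
  polyfun f -> polyfun g ->
  (forall z, re z > 0 -> f z = g z) -> forall z, f z = g z.
Proof.
  intros Hf Hg H z.
  destruct (polyfun_sub f g Hf Hg) as [l Hl].
  assert (E : Peval l z = C0).
  { apply Peval_halfplane_eq0; intros w Hw; rewrite <- Hl, (H w Hw); ring. }
  rewrite <- Hl in E.
  replace (f z) with ((f z - g z) + g z)%Cx by ring.
  rewrite E; ring.
Qed.

(** * Rational functions on the right half-plane *)

(** Regularity at [mu] of the rational continuation of [f]: only values for [re z > 0] enter, where
    the Laplace transforms converge, while the points [mu] of interest lie outside that
    half-plane. *)
Definition regular_at (mu : C) (f : C -> C) : Prop :=
  exists P D, polyfun P /\ polyfun D /\ D mu <> C0 /\
    forall z, re z > 0 -> D z <> C0 /\ f z = (P z / D z)%Cx.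

Lemma regular_at_ext (mu : C) (f g : C -> C) :
  (forall z, re z > 0 -> f z = g z) -> regular_at mu f -> regular_at mu g.
Proof.
  intros E (P & D & HP & HD & Hmu & H).
  exists P, D; repeat split; try assumption; [now apply H|].
  rewrite <- E by assumption; now apply H.
Qed.

Lemma regular_at_add (mu : C) (f g : C -> C) :
  regular_at mu f -> regular_at mu g -> regular_at mu (fun z => f z + g z)%Cx.
Proof.
  intros (P & D & HP & HD & Hmu & H) (P' & D' & HP' & HD' & Hmu' & H').
  exists (fun z => P z * D' z + P' z * D z)%Cx, (fun z => D z * D' z)%Cx.
  split; [apply polyfun_add; now apply polyfun_mul|].
  split; [now apply polyfun_mul|].
  split; [intros E; apply Cmul_integral in E; tauto|].
  intros z Hz; destruct (H z Hz) as [Hd ->], (H' z Hz) as [Hd' ->].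
  split; [intros E; apply Cmul_integral in E; tauto|].
  field; split; assumption.
Qed.

Lemma regular_at_const (mu c : C) : regular_at mu (fun _ => c).
Proof.
  exists (fun _ => c), (fun _ => C1).
  split; [apply polyfun_const|split; [apply polyfun_const|]].
  split; [apply C1_neq_0|].
  intros z _; split; [apply C1_neq_0|field].
  apply C1_neq_0.
Qed.

Lemma regular_at_simple (mu lam c : C) :
  re lam <= 0 -> lam <> mu -> regular_at mu (fun z => c / (z - lam))%Cx.
Proof.
  intros Hre Hne.
  exists (fun _ => c), (fun z => z - lam)%Cx.
  split; [apply polyfun_const|].
  split; [apply polyfun_sub; [apply polyfun_id|apply polyfun_const]|].
  split; [apply Csub_neq0; congruence|].
  intros z Hz; split; [apply Csub_neq0_re; lra|reflexivity].
Qed.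

Lemma regular_at_Csum (mu : C) (n : nat) (f : nat -> C -> C) :
  (forall k, (k < n)%nat -> regular_at mu (f k)) ->
  regular_at mu (fun z => Csum n (fun k => f k z)).
Proof.
  induction n as [|n IH]; intros H; simpl.
  - apply regular_at_const.
  - apply regular_at_add; auto.
Qed.

(** Clearing denominators gives [(z - mu) * P z = c * D z] on the half-plane, hence everywhere. At
    [z = mu] the left side vanishes, whereas [D mu] does not. *)
Lemma regular_at_residue (mu c : C) (f : C -> C) :
  re mu <= 0 -> regular_at mu f ->
  (forall z, re z > 0 -> f z = (c / (z - mu))%Cx) -> c = C0.
Proof.
  intros Hmu (P & D & HP & HD & HDmu & H) E.
  assert (Hpoly : forall z, ((z - mu) * P z = c * D z)%Cx).
  { apply polyfun_halfplane_eq.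
    - apply polyfun_mul; [|assumption].
      apply polyfun_sub; [apply polyfun_id|apply polyfun_const].
    - now apply polyfun_scal.
    - intros z Hz; destruct (H z Hz) as [Hd Hf].
      assert (Hzm : (z - mu)%Cx <> C0) by (apply Csub_neq0_re; lra).
      rewrite (E z Hz) in Hf.
      replace (P z) with (P z / D z * D z)%Cx by (field; exact Hd).
      rewrite <- Hf; field; exact Hzm. }
  specialize (Hpoly mu).
  assert (Hz : (c * D mu)%Cx = C0) by (rewrite <- Hpoly; ring).
  apply Cmul_integral in Hz; tauto.
Qed.

(** Opposes the unboundedness demanded by [has_pole]. [D] may vanish at [mu] through a common factor
    with [P]; cross-multiplication shows that, wherever [D] is nonzero near [mu], the fraction
    equals one whose denominator stays away from zero. *)
Lemma regular_at_bounded (mu : C) (f : C -> C) (P D : list C) :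
  regular_at mu f ->
  (forall z, re z > 0 -> Peval D z <> C0 /\ f z = (Peval P z / Peval D z)%Cx) ->
  exists B delta, delta > 0 /\ forall z, Cnorm (z - mu) < delta ->
    Peval D z <> C0 -> Cnorm (Peval P z / Peval D z) <= B.
Proof.
  intros (P1 & D1 & [p1 HP] & [d1 HD] & HDmu & H) E.
  assert (Hpoly : forall z, (Peval P z * D1 z = P1 z * Peval D z)%Cx).
  { apply polyfun_halfplane_eq.
    - apply polyfun_mul; [apply polyfun_Peval|now exists d1].
    - apply polyfun_mul; [now exists p1|apply polyfun_Peval].
    - intros z Hz; destruct (H z Hz) as [Hd1 Hf1], (E z Hz) as [Hd Hf].
      rewrite Hf in Hf1.
      replace (Peval P z) with (Peval P z / Peval D z * Peval D z)%Cx by (field; exact Hd).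
      rewrite Hf1; field; exact Hd1. }
  destruct (Peval_bounded p1 mu) as [B1 [HB1 Hb1]].
  destruct (Peval_bounded (Psynth d1 mu) mu) as [B2 [HB2 Hb2]].
  set (m := Cnorm (D1 mu)).
  assert (Hm : 0 < m) by now apply Cnorm_gt0.
  (* The bounds [B1] and [B2] hold on the disc of radius 1. The second radius keeps [D1 z] within
     [m / 2] of [D1 mu]; its [+ 1] allows [B2 = 0]. *)
  exists (B1 * (2 / m)), (Rmin 1 (m / (2 * (B2 + 1)))).
  assert (Hq : 0 < m / (2 * (B2 + 1))) by (apply Rdiv_lt_0_compat; lra).
  split; [apply Rmin_glb_lt; lra|].
  intros z Hz Hdz.
  assert (Hz1 : Cnorm (z - mu) <= 1) by (generalize (Rmin_l 1 (m / (2 * (B2 + 1)))); lra).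
  assert (Hz2 : Cnorm (z - mu) <= m / (2 * (B2 + 1)))
    by (generalize (Rmin_r 1 (m / (2 * (B2 + 1)))); lra).
  assert (HD1 : m / 2 <= Cnorm (D1 z)).
  { assert (Heq : D1 mu = (D1 z + - ((z - mu) * Peval (Psynth d1 mu) z))%Cx).
    { rewrite (HD z), (Psynth_spec d1 z mu), HD; ring. }
    assert (Hn : m <= Cnorm (D1 z) + Cnorm (z - mu) * Cnorm (Peval (Psynth d1 mu) z)).
    { unfold m; rewrite Heq at 1.
      eapply Rle_trans; [apply Cnorm_add|]; rewrite Cnorm_opp, Cnorm_mul; lra. }
    assert (Cnorm (z - mu) * Cnorm (Peval (Psynth d1 mu) z) <= m / (2 * (B2 + 1)) * B2).
    { apply Rmult_le_compat; try apply Cnorm_ge0; [assumption|now apply Hb2]. }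
    assert (m / (2 * (B2 + 1)) * B2 <= m / 2).
    { replace (m / 2) with (m / (2 * (B2 + 1)) * (B2 + 1)) by (field; lra).
      apply Rmult_le_compat_l; lra. }
    lra. }
  assert (HD1z : D1 z <> C0) by (intros E0; rewrite E0, Cnorm_C0 in HD1; lra).
  replace (Peval P z / Peval D z)%Cx with (P1 z * Cinv (D1 z))%Cx.
  - rewrite Cnorm_mul; apply Rmult_le_compat; try apply Cnorm_ge0.
    + rewrite HP; now apply Hb1.
    + assert (Hi : Cnorm (D1 z) * Cnorm (Cinv (D1 z)) = 1).
      { rewrite <- Cnorm_mul, <- Cnorm_C1; f_equal; field; exact HD1z. }
      replace (2 / m) with (2 / m * (Cnorm (D1 z) * Cnorm (Cinv (D1 z)))) by (rewrite Hi; ring).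
      assert (1 <= 2 / m * Cnorm (D1 z)).
      { replace 1 with (2 / m * (m / 2)) by (field; lra).
        apply Rmult_le_compat_l; [|assumption].
        apply Rlt_le, Rdiv_lt_0_compat; lra. }
      generalize (Cnorm_ge0 (Cinv (D1 z))); nra.
  - apply (Cmul_cancel_l (D1 z)); [assumption|].
    transitivity (P1 z); [field; exact HD1z|].
    replace (P1 z) with (P1 z * Peval D z / Peval D z)%Cx by (field; exact Hdz).
    rewrite <- Hpoly; field; exact Hdz.
Qed.

(** Covers both ways in which a pole can be absent: the coefficient at [mu] vanishes, or [mu] is
    none of the [lam k]. *)
Lemma partial_fractions_regular (n : nat) (lam c : nat -> C) (mu : C) :
  (forall k, (k < n)%nat -> re (lam k) <= 0) ->
  (forall k, (k < n)%nat -> lam k = mu -> c k = C0) ->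
  regular_at mu (fun z => Csum n (fun k => c k / (z - lam k))%Cx).
Proof.
  intros Hre Hc; apply (regular_at_Csum mu n (fun k z => c k / (z - lam k))%Cx).
  intros k Hk; destruct (classic (lam k = mu)) as [E|E].
  - apply (regular_at_ext mu (fun _ => C0)); [|apply regular_at_const].
    intros z Hz; rewrite (Hc k Hk E); field.
    apply Csub_neq0_re; specialize (Hre k Hk); lra.
  - apply regular_at_simple; auto.
Qed.

(** Subtracting from [f] all terms but the k-th leaves [c k / (z - lam k)], which is regular at
    [lam k] only if [c k] is zero. A general [f] allows a partial fraction over another spectrum on
    the right. *)
Lemma partial_fractions_residue (n : nat) (lam c : nat -> C) (f : C -> C) (k : nat) :
  (forall i, (i < n)%nat -> re (lam i) <= 0) ->
  (forall i j, (i < n)%nat -> (j < n)%nat -> lam i = lam j -> i = j) ->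
  (k < n)%nat -> regular_at (lam k) f ->
  (forall z, re z > 0 -> Csum n (fun i => c i / (z - lam i))%Cx = f z) ->
  c k = C0.
Proof.
  intros Hre Hinj Hk Hf E.
  pose (c' := fun i => if Nat.eqb i k then C0 else c i).
  apply (regular_at_residue (lam k) (c k)
    (fun z => f z + - C1 * Csum n (fun i => c' i / (z - lam i)))%Cx); [auto| |].
  - apply regular_at_add; [assumption|].
    apply (regular_at_ext _ (fun z => Csum n (fun i => (- C1 * c' i) / (z - lam i)))%Cx).
    + intros z Hz; rewrite <- Csum_scal; apply Csum_ext; intros i Hi.
      field; apply Csub_neq0_re; specialize (Hre i Hi); lra.
    + apply partial_fractions_regular; [assumption|].
      intros i Hi Ei; apply Hinj in Ei; [|assumption|assumption]; subst i.
      unfold c'; rewrite Nat.eqb_refl; ring.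
  - intros z Hz; rewrite <- E by assumption.
    rewrite <- (Csum_unitv n k (fun i => c i / (z - lam i))%Cx Hk).
    rewrite <- Csum_scal, <- Csum_add; apply Csum_ext; intros i Hi.
    assert (Hne : (z - lam i)%Cx <> C0)
      by (apply Csub_neq0_re; specialize (Hre i Hi); lra).
    unfold c', unitv; destruct (Nat.eqb i k); field; exact Hne.
Qed.

(** * Diagonalisation *)

(** Gaussian elimination, by induction on the number of equations, with the pivot taken in the last
    row. *)
Lemma underdetermined_system (n : nat) (A : nat -> nat -> C) :
  exists c : nat -> C, (exists k, (k <= n)%nat /\ c k <> C0) /\
    forall r, (r < n)%nat -> Csum (S n) (fun k => A r k * c k)%Cx = C0.
Proof.
  revert A; induction n as [|n IH]; intros A.
  - exists (fun _ => C1); split; [|lia].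
    exists 0%nat; split; [lia|apply C1_neq_0].
  - destruct (classic (exists k0, (k0 <= S n)%nat /\ A n k0 <> C0)) as [(k0 & Hk0 & Hp)|Hno].
    + pose (sk := fun k => if Nat.ltb k k0 then k else S k).
      destruct (IH (fun r k => A r (sk k) - A r k0 * (A n (sk k) / A n k0))%Cx)
        as (c & (k1 & Hk1 & Hc1) & Hc).
      (* The other unknowns solve the reduced system; the unknown [k0] is read off the last
         equation. *)
      pose (c' := fun k => if Nat.ltb k k0 then c k else
        if Nat.eqb k k0 then (- Csum (S n) (fun i => A n (sk i) / A n k0 * c i))%Cx
        else c (k - 1)%nat).
      assert (Hsk : forall k, c' (sk k) = c k).
      { intros k; unfold c', sk; destruct (Nat.ltb_spec k k0) as [H|H].
        - destruct (Nat.ltb_spec k k0); [reflexivity|lia].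
        - destruct (Nat.ltb_spec (S k) k0); [lia|].
          destruct (Nat.eqb_spec (S k) k0); [lia|f_equal; lia]. }
      assert (Hck0 : c' k0 = (- Csum (S n) (fun i => A n (sk i) / A n k0 * c i))%Cx).
      { unfold c'; destruct (Nat.ltb_spec k0 k0); [lia|]; now rewrite Nat.eqb_refl. }
      exists c'; split.
      { exists (sk k1); split; [unfold sk; destruct (Nat.ltb k1 k0); lia|now rewrite Hsk]. }
      intros r Hr; rewrite (Csum_remove (S n) k0) by assumption.
      fold sk; rewrite Hck0.
      replace (A r k0 * - Csum (S n) (fun i => A n (sk i) / A n k0 * c i))%Cx
        with (Csum (S n) (fun i => - A r k0 * (A n (sk i) / A n k0 * c i)))%Cx
        by (rewrite Csum_scal; ring).
      rewrite <- Csum_add.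
      destruct (Nat.eq_dec r n) as [->|Hrn].
      * apply Csum_eq0; intros k _; change (if Nat.ltb k k0 then k else S k) with (sk k).
        rewrite Hsk; field; exact Hp.
      * rewrite <- (Hc r) by lia; apply Csum_ext; intros k _.
        change (if Nat.ltb k k0 then k else S k) with (sk k); rewrite Hsk; ring.
    (* The last equation is trivial here: it is dropped, and the last unknown is set to zero. *)
    + destruct (IH A) as (c & (k1 & Hk1 & Hc1) & Hc).
      exists (fun k => if Nat.ltb k (S n) then c k else C0); split.
      * exists k1; split; [lia|]; destruct (Nat.ltb_spec k1 (S n)); [assumption|lia].
      * intros r Hr; change (Csum (S (S n)) ?f) with (Csum (S n) f + f (S n))%Cx.
        cbv beta; rewrite Nat.ltb_irrefl.
        rewrite (Csum_ext (S n) _ (fun k => A r k * c k)%Cx)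
          by (intros k Hk; destruct (Nat.ltb_spec k (S n)); [reflexivity|lia]).
        destruct (Nat.eq_dec r n) as [->|Hrn].
        -- rewrite Csum_eq0; [ring|]; intros k Hk.
           destruct (classic (A n k = C0)) as [->|E]; [ring|].
           exfalso; apply Hno; exists k; split; [lia|assumption].
        -- rewrite Hc by lia; ring.
Qed.

Definition diagonalizes (n : nat) (A : Mat) (lam : nat -> C) (V W : Mat) : Prop :=
  (forall i j, (i < n)%nat -> (j < n)%nat ->
     Csum n (fun k => V i k * W k j)%Cx = Mid i j) /\
  (forall k l, (k < n)%nat -> (l < n)%nat ->
     Csum n (fun i => W k i * V i l)%Cx = Mid k l) /\
  (forall i k, (i < n)%nat -> (k < n)%nat ->
     Csum n (fun j => A i j * V j k)%Cx = (lam k * V i k)%Cx).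

(* Applying [A - mu] to a vanishing combination of eigenvectors multiplies the
   k-th coefficient by [lam k - mu]; running over all [mu = lam l] with [l <> k0]
   leaves only the k0-th term. *)
Lemma eigenvectors_free (n : nat) (A V : Mat) (lam c : nat -> C) :
  (forall k l, (k < n)%nat -> (l < n)%nat -> lam k = lam l -> k = l) ->
  (forall i k, (i < n)%nat -> (k < n)%nat ->
     Csum n (fun j => A i j * V j k)%Cx = (lam k * V i k)%Cx) ->
  (forall k, (k < n)%nat -> exists i, (i < n)%nat /\ V i k <> C0) ->
  (forall i, (i < n)%nat -> Csum n (fun k => V i k * c k)%Cx = C0) ->
  forall k, (k < n)%nat -> c k = C0.
Proof.
  intros Hinj HA HV Hc k0 Hk0.
  pose (fac := fun (L : list nat) k =>
    fold_right (fun l z => (lam k - lam l) * z)%Cx C1 L).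
  assert (H : forall L i, (i < n)%nat -> Csum n (fun k => V i k * (fac L k * c k))%Cx = C0).
  { induction L as [|l L IH]; intros i Hi.
    - rewrite <- (Hc i Hi); apply Csum_ext; intros k _; simpl; ring.
    - transitivity (Csum n (fun j => A i j * Csum n (fun k => V j k * (fac L k * c k)))
        - lam l * Csum n (fun k => V i k * (fac L k * c k)))%Cx.
      + rewrite (Csum_ext n (fun j => A i j * _)%Cx
          (fun j => Csum n (fun k => A i j * V j k * (fac L k * c k)))%Cx)
          by (intros j _; rewrite <- Csum_scal; apply Csum_ext; intros; ring).
        rewrite Csum_swap, <- Csum_scal, <- Csum_sub; apply Csum_ext; intros k Hk.
        rewrite Csum_scal_r, HA by assumption; simpl; ring.
      + rewrite (IH i Hi), (Csum_eq0 n); [ring|].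
        intros j Hj; rewrite (IH j Hj); ring. }
  pose (L := filter (fun k => negb (Nat.eqb k k0)) (seq 0 n)).
  assert (HL0 : forall L', (forall l, In l L' -> (l < n)%nat /\ l <> k0) -> fac L' k0 <> C0).
  { induction L' as [|l L' IH]; intros HL'; simpl; [apply C1_neq_0|].
    intros E; apply Cmul_integral in E; destruct E as [E|E].
    - destruct (HL' l) as [Hl Hne]; [now left|].
      revert E; apply Csub_neq0; intros E; apply Hinj in E; auto.
    - revert E; apply IH; intros l' Hl'; apply HL'; now right. }
  assert (HLk : forall L' k, In k L' -> fac L' k = C0).
  { induction L' as [|l L' IH]; intros k Hk; [destruct Hk|destruct Hk as [E|E]]; simpl.
    - subst l; ring.
    - rewrite IH by assumption; ring. }
  destruct (HV k0 Hk0) as (i & Hi & HVi).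
  assert (Hsum : Csum n (fun k => V i k * (fac L k * c k))%Cx = (V i k0 * (fac L k0 * c k0))%Cx).
  { rewrite <- (Csum_unitv n k0 (fun k => V i k * (fac L k * c k))%Cx Hk0).
    apply Csum_ext; intros k Hk; unfold unitv; destruct (Nat.eqb_spec k k0); [ring|].
    rewrite HLk; [ring|]; apply filter_In; split; [apply in_seq; lia|].
    destruct (Nat.eqb_spec k k0); [contradiction|reflexivity]. }
  rewrite H in Hsum by assumption; symmetry in Hsum.
  apply Cmul_integral in Hsum; destruct Hsum as [E|E]; [contradiction|].
  apply Cmul_integral in E; destruct E as [E|E]; [|assumption].
  exfalso; revert E; apply HL0; intros l Hl; apply filter_In in Hl.
  destruct Hl as [Hl Hne]; apply in_seq in Hl; split; [lia|].
  intros ->; rewrite Nat.eqb_refl in Hne; discriminate.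
Qed.

Lemma distinct_eigenvalues_diagonalize (n : nat) (A : Mat) (lam : nat -> C) :
  (forall k, (k < n)%nat -> eigenvalue n A (lam k)) ->
  (forall k l, (k < n)%nat -> (l < n)%nat -> lam k = lam l -> k = l) ->
  exists V W, diagonalizes n A lam V W.
Proof.
  intros Heig Hinj.
  assert (HV : forall k, exists v : nat -> C, (k < n)%nat ->
    (exists i, (i < n)%nat /\ v i <> C0) /\
    forall i, (i < n)%nat -> Csum n (fun j => A i j * v j)%Cx = (lam k * v i)%Cx).
  { intros k; destruct (classic (k < n)%nat) as [Hk|Hk].
    - destruct (Heig k Hk) as [v Hv]; exists v; auto.
    - exists (fun _ => C0); intros; contradiction. }
  apply choice in HV; destruct HV as [v Hv].
  pose (V := fun i k => v k i).
  assert (HAV : forall i k, (i < n)%nat -> (k < n)%nat ->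
     Csum n (fun j => A i j * V j k)%Cx = (lam k * V i k)%Cx).
  { intros i k Hi Hk; now apply (proj2 (Hv k Hk)). }
  assert (Hfree : forall c, (forall i, (i < n)%nat -> Csum n (fun k => V i k * c k)%Cx = C0) ->
    forall k, (k < n)%nat -> c k = C0).
  { intros c; apply (eigenvectors_free n A V lam c); try assumption.
    intros k Hk; now apply (proj1 (Hv k Hk)). }
  assert (HW : forall j, exists w : nat -> C, (j < n)%nat -> forall i, (i < n)%nat ->
    Csum n (fun k => V i k * w k)%Cx = Mid i j).
  (* A nontrivial relation between the columns of [V] and the j-th unit vector. Freeness of the
     columns forces its last coefficient to be nonzero, and dividing by it expands the unit vector
     in eigenvectors. *)
  { intros j; destruct (underdetermined_system n
      (fun i k => if Nat.ltb k n then V i k else Mid i j)) as (c & (k1 & Hk1 & Hc1) & Hc).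
    assert (Hc' : forall i, (i < n)%nat ->
      (Csum n (fun k => V i k * c k) + Mid i j * c n = C0)%Cx).
    { intros i Hi; rewrite <- (Hc i Hi).
      change (Csum (S n) ?f) with (Csum n f + f n)%Cx; cbv beta.
      rewrite Nat.ltb_irrefl; f_equal; apply Csum_ext; intros k Hk.
      destruct (Nat.ltb_spec k n); [reflexivity|lia]. }
    assert (Hn : c n <> C0).
    { intros E; apply Hc1; destruct (Nat.eq_dec k1 n) as [->|Hne]; [assumption|].
      apply Hfree; [|lia]; intros i Hi; generalize (Hc' i Hi); rewrite E; intros <-; ring. }
    exists (fun k => - c k / c n)%Cx; intros _ i Hi.
    replace (Mid i j) with ((- C1 / c n) * (C0 - Mid i j * c n))%Cx by (field; exact Hn).
    rewrite <- (Hc' i Hi).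
    replace (Csum n (fun k => V i k * c k) + Mid i j * c n - Mid i j * c n)%Cx
      with (Csum n (fun k => V i k * c k))%Cx by ring.
    rewrite <- Csum_scal; apply Csum_ext; intros k _; field; exact Hn. }
  apply choice in HW; destruct HW as [w Hw].
  pose (W := fun k j => w j k).
  assert (HVW : forall i j, (i < n)%nat -> (j < n)%nat ->
    Csum n (fun k => V i k * W k j)%Cx = Mid i j).
  { intros i j Hi Hj; now apply Hw. }
  exists V, W; split; [assumption|split; [|assumption]].
  intros k l Hk Hl.
  (* The right inverse is also a left one: [V (W V - 1) = (V W) V - V = 0], and the columns of [V]
     are free. *)
  assert (E : (Csum n (fun i => W k i * V i l) - Mid k l)%Cx = C0).
  { apply (Hfree (fun k => Csum n (fun i => W k i * V i l) - Mid k l)%Cx); [|assumption].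
    intros i Hi.
    transitivity (Csum n (fun k => Csum n (fun j => V i k * W k j * V j l))
      - Csum n (fun k => V i k * unitv l k))%Cx.
    { rewrite <- Csum_sub; apply Csum_ext; intros k' _.
      rewrite (Csum_ext n (fun j => V i k' * W k' j * V j l)%Cx (fun j => V i k' * (W k' j * V j l)))%Cx by (intros; ring).
      rewrite Csum_scal; unfold Mid, unitv; ring. }
    rewrite Csum_unitv, Csum_swap by assumption.
    rewrite (Csum_ext n _ (fun j => Mid i j * V j l))%Cx
      by (intros j Hj; now rewrite Csum_scal_r, HVW).
    rewrite Csum_Mid_l by assumption; ring. }
  replace (Mid k l) with (C0 + Mid k l)%Cx by ring.
  rewrite <- E; ring.
Qed.

(** * The matrix exponential *)

Fixpoint Cpow (z : C) (m : nat) : C :=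
  match m with O => C1 | S m' => (z * Cpow z m')%Cx end.

Lemma Cnorm_Cpow (z : C) (m : nat) : Cnorm (Cpow z m) = Cnorm z ^ m.
Proof.
  induction m as [|m IH]; simpl; [apply Cnorm_C1|now rewrite Cnorm_mul, IH].
Qed.

Lemma re_le_Cnorm (z : C) : Rabs (re z) <= Cnorm z.
Proof.
  unfold Cnorm; rewrite <- sqrt_Rsqr_abs; apply sqrt_le_1_alt; unfold Rsqr; nra.
Qed.

Lemma im_le_Cnorm (z : C) : Rabs (im z) <= Cnorm z.
Proof.
  unfold Cnorm; rewrite <- sqrt_Rsqr_abs; apply sqrt_le_1_alt; unfold Rsqr; nra.
Qed.

Lemma CV_radius_exp_bounded (a : nat -> R) (r : R) :
  (forall m, Rabs (a m) <= r ^ m / INR (fact m)) -> CV_radius a = p_infty.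
Proof.
  intros H; apply is_lub_Rbar_unique; split; [now intros x _|].
  intros b Hb.
  assert (Hx : forall x : R, Rbar_le x b).
  { intros x; apply Hb.
    apply (@ex_series_le R_AbsRing R_CompleteNormedModule) with (b := fun m => (r * Rabs x) ^ m / INR (fact m)).
    - intros m; unfold norm; simpl; unfold abs; simpl; rewrite Rabs_Rabsolu, Rabs_mult.
      rewrite <- RPow_abs, Rpow_mult_distr.
      replace (r ^ m * Rabs x ^ m / INR (fact m)) with (r ^ m / INR (fact m) * Rabs x ^ m)
        by (unfold Rdiv; ring).
      apply Rmult_le_compat_r; [apply pow_le, Rabs_pos|apply H].
    - exists (exp (r * Rabs x)).
      generalize (is_exp_Reals (r * Rabs x)); unfold is_pseries.
      apply is_series_ext; intros m; unfold scal; simpl; unfold mult; simpl.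
      rewrite pow_n_pow; unfold Rdiv; ring. }
  destruct b as [b| |]; simpl in *; try easy.
  specialize (Hx (b + 1)); simpl in Hx; lra.
Qed.

(** The property from which [Clim] selects by [epsilon]: exhibiting a limit determines [Clim u]. *)
Definition Ccv (u : nat -> C) (l : C) : Prop :=
  Un_cv (fun k => re (u k)) (re l) /\ Un_cv (fun k => im (u k)) (im l).

Lemma Ccv_add (u v : nat -> C) (l m : C) :
  Ccv u l -> Ccv v m -> Ccv (fun k => u k + v k)%Cx (l + m)%Cx.
Proof. intros [] []; split; simpl; now apply CV_plus. Qed.

Lemma Ccv_const (l : C) : Ccv (fun _ => l) l.
Proof. split; intros eps He; exists 0%nat; intros; rewrite R_dist_eq; exact He. Qed.

Lemma Ccv_mul (u v : nat -> C) (l m : C) :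
  Ccv u l -> Ccv v m -> Ccv (fun k => u k * v k)%Cx (l * m)%Cx.
Proof.
  intros [] []; split; simpl; [apply CV_minus|apply CV_plus]; now apply CV_mult.
Qed.

Lemma Ccv_Csum (n : nat) (u : nat -> nat -> C) (l : nat -> C) :
  (forall i, (i < n)%nat -> Ccv (u i) (l i)) ->
  Ccv (fun k => Csum n (fun i => u i k)) (Csum n l).
Proof.
  induction n as [|n IH]; intros H; simpl; [apply Ccv_const|].
  apply Ccv_add; auto.
Qed.

Lemma Ccv_ext (u v : nat -> C) (l : C) :
  (forall k, u k = v k) -> Ccv u l -> Ccv v l.
Proof. intros H; replace v with u; [easy|]; now apply functional_extensionality. Qed.

Lemma Clim_unique (u : nat -> C) (l : C) : Ccv u l -> Clim u = l.
Proof.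
  intros H; unfold Clim.
  destruct (epsilon_spec C_inhabited (fun l => Ccv u l) (ex_intro _ l H)) as [Hr Hi].
  destruct H as [Hr' Hi']; apply C_ext; eapply UL_sequence; eauto.
Qed.

Lemma re_Csum (n : nat) (f : nat -> C) : re (Csum (S n) f) = sum_n (fun k => re (f k)) n.
Proof.
  induction n as [|n IH]; [rewrite sum_O; simpl; ring|].
  rewrite sum_Sn, <- IH; reflexivity.
Qed.

Lemma im_Csum (n : nat) (f : nat -> C) : im (Csum (S n) f) = sum_n (fun k => im (f k)) n.
Proof.
  induction n as [|n IH]; [rewrite sum_O; simpl; ring|].
  rewrite sum_Sn, <- IH; reflexivity.
Qed.

(* Both sides solve [y' = z y], [y 0 = 1]: the quotient by [Cexp (z t)] has zero
   derivative. *)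
Lemma Cexp_series (z : C) (t : R) :
  Ccv (fun K => Csum (S K) (fun m => RtoC (t ^ m / INR (fact m)) * Cpow z m)%Cx)
      (Cexp (z * RtoC t)).
Proof.
  pose (a := fun m => re (Cpow z m) / INR (fact m)).
  pose (b := fun m => im (Cpow z m) / INR (fact m)).
  assert (Hfact : forall m, 0 < INR (fact m)) by (intros m; apply INR_fact_lt_0).
  assert (Ha : CV_radius a = p_infty).
  { apply (CV_radius_exp_bounded a (Cnorm z)); intros m; unfold a, Rdiv.
    rewrite Rabs_mult, (Rabs_right (/ _)), <- Cnorm_Cpow.
    - apply Rmult_le_compat_r; [apply Rlt_le, Rinv_0_lt_compat, Hfact|apply re_le_Cnorm].
    - apply Rle_ge, Rlt_le, Rinv_0_lt_compat, Hfact. }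
  assert (Hb : CV_radius b = p_infty).
  { apply (CV_radius_exp_bounded b (Cnorm z)); intros m; unfold b, Rdiv.
    rewrite Rabs_mult, (Rabs_right (/ _)), <- Cnorm_Cpow.
    - apply Rmult_le_compat_r; [apply Rlt_le, Rinv_0_lt_compat, Hfact|apply im_le_Cnorm].
    - apply Rle_ge, Rlt_le, Rinv_0_lt_compat, Hfact. }
  assert (Hexa : forall x, ex_pseries a x)
    by (intros x; apply CV_radius_inside; rewrite Ha; exact I).
  assert (Hexb : forall x, ex_pseries b x)
    by (intros x; apply CV_radius_inside; rewrite Hb; exact I).
  pose (x := re z); pose (y := im z).
  assert (HdA : forall s, is_derive (PSeries a) s (x * PSeries a s - y * PSeries b s)).
  { intros s; replace (x * PSeries a s - y * PSeries b s) with (PSeries (PS_derive a) s).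
    - apply is_derive_PSeries; rewrite Ha; exact I.
    - rewrite (PSeries_ext (PS_derive a) (PS_minus (PS_scal x a) (PS_scal y b))).
      + rewrite PSeries_minus, !PSeries_scal; [reflexivity| |];
          apply ex_pseries_scal; auto using Rmult_comm.
      + intros m; unfold PS_derive, PS_minus, PS_plus, PS_opp, PS_scal, a, b.
        unfold plus, opp, scal; simpl; unfold mult; simpl.
        change (fact m + m * fact m)%nat with (fact (S m)).
        rewrite fact_simpl, mult_INR; fold x y.
        change (match m with 0%nat => 1 | S _ => INR m + 1 end) with (INR (S m)).
        field; split; [apply Rgt_not_eq, Hfact|apply not_0_INR; lia]. }
  assert (HdB : forall s, is_derive (PSeries b) s (x * PSeries b s + y * PSeries a s)).
  { intros s; replace (x * PSeries b s + y * PSeries a s) with (PSeries (PS_derive b) s).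
    - apply is_derive_PSeries; rewrite Hb; exact I.
    - rewrite (PSeries_ext (PS_derive b) (PS_plus (PS_scal x b) (PS_scal y a))).
      + rewrite PSeries_plus, !PSeries_scal; [reflexivity| |];
          apply ex_pseries_scal; auto using Rmult_comm.
      + intros m; unfold PS_derive, PS_plus, PS_scal, a, b.
        unfold plus, scal; simpl; unfold mult; simpl.
        change (fact m + m * fact m)%nat with (fact (S m)).
        rewrite fact_simpl, mult_INR; fold x y.
        change (match m with 0%nat => 1 | S _ => INR m + 1 end) with (INR (S m)).
        field; split; [apply Rgt_not_eq, Hfact|apply not_0_INR; lia]. }
  (* [G] and [H] are the real and imaginary parts of [Cexp (- (z s))] times the series. Being
     constant, they equal 1 and 0; undoing the rotation by [y t] then recovers both real series. *)
  pose (G := fun s => exp (- (x * s)) * (PSeries a s * cos (y * s) + PSeries b s * sin (y * s))).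
  pose (H := fun s => exp (- (x * s)) * (PSeries b s * cos (y * s) - PSeries a s * sin (y * s))).
  assert (HA' : forall s, Derive (PSeries a) s = x * PSeries a s - y * PSeries b s)
    by (intros s; apply is_derive_unique, HdA).
  assert (HB' : forall s, Derive (PSeries b) s = x * PSeries b s + y * PSeries a s)
    by (intros s; apply is_derive_unique, HdB).
  assert (HeA : forall s, ex_derive (PSeries a) s) by (intros s; eexists; apply HdA).
  assert (HeB : forall s, ex_derive (PSeries b) s) by (intros s; eexists; apply HdB).
  assert (HG : forall s, is_derive G s 0).
  { intros s; unfold G; auto_derive; [auto|].
    change (fun x0 => PSeries a x0) with (PSeries a); change (fun x0 => PSeries b x0) with (PSeries b).
    rewrite HA', HB'; ring. }
  assert (HH : forall s, is_derive H s 0).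
  { intros s; unfold H; auto_derive; [auto|].
    change (fun x0 => PSeries a x0) with (PSeries a); change (fun x0 => PSeries b x0) with (PSeries b).
    rewrite HA', HB'; ring. }
  assert (Hconst : forall f : R -> R, (forall s, is_derive f s 0) -> f t = f 0).
  { intros f Hf; destruct (MVT_gen f 0 t (fun _ => 0)) as [c [_ Hc]].
    - intros; apply Hf.
    - intros s _; apply continuity_pt_filterlim, (ex_derive_continuous f); eexists; apply Hf.
    - lra. }
  assert (HG1 : G t = 1).
  { transitivity (G 0).
    - now apply Hconst.
    - unfold G; rewrite !PSeries_0; unfold a, b; simpl; rewrite !Rmult_0_r, cos_0, sin_0, Ropp_0, exp_0; field. }
  assert (HH0 : H t = 0).
  { transitivity (H 0).
    - now apply Hconst.
    - unfold H; rewrite !PSeries_0; unfold a, b; simpl; rewrite !Rmult_0_r, cos_0, sin_0, Ropp_0, exp_0; field. }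
  assert (He : exp (x * t) * exp (- (x * t)) = 1).
  { rewrite <- exp_plus, <- exp_0; f_equal; ring. }
  assert (Hsc : sin (y * t) * sin (y * t) + cos (y * t) * cos (y * t) = 1) by apply sin2_cos2.
  assert (EA : PSeries a t = exp (x * t) * cos (y * t)).
  { transitivity (exp (x * t) * (cos (y * t) * G t - sin (y * t) * H t)); [|rewrite HG1, HH0; ring].
    unfold G, H.
    transitivity (PSeries a t * (exp (x * t) * exp (- (x * t)))
      * (sin (y * t) * sin (y * t) + cos (y * t) * cos (y * t))); [rewrite He, Hsc; ring|ring]. }
  assert (EB : PSeries b t = exp (x * t) * sin (y * t)).
  { transitivity (exp (x * t) * (sin (y * t) * G t + cos (y * t) * H t)); [|rewrite HG1, HH0; ring].
    unfold G, H.
    transitivity (PSeries b t * (exp (x * t) * exp (- (x * t)))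
      * (sin (y * t) * sin (y * t) + cos (y * t) * cos (y * t))); [rewrite He, Hsc; ring|ring]. }
  split.
  - replace (re (Cexp (z * RtoC t))) with (PSeries a t).
    + apply is_lim_seq_Reals.
      apply (is_lim_seq_ext (sum_n (fun k => scal (pow_n t k) (a k))));
        [|exact (PSeries_correct a t (Hexa t))]; intros K.
      rewrite re_Csum; apply sum_n_ext; intros m; rewrite pow_n_pow; unfold scal, a; simpl.
      unfold mult; simpl; unfold Rdiv; ring.
    + rewrite EA; simpl; fold x y; f_equal; f_equal; ring.
  - replace (im (Cexp (z * RtoC t))) with (PSeries b t).
    + apply is_lim_seq_Reals.
      apply (is_lim_seq_ext (sum_n (fun k => scal (pow_n t k) (b k))));
        [|exact (PSeries_correct b t (Hexb t))]; intros K.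
      rewrite im_Csum; apply sum_n_ext; intros m; rewrite pow_n_pow; unfold scal, b; simpl.
      unfold mult; simpl; unfold Rdiv; ring.
    + rewrite EB; simpl; fold x y; f_equal; f_equal; ring.
Qed.

Lemma Mpow_diag (n : nat) (A : Mat) (lam : nat -> C) (V W : Mat) (m i j : nat) :
  diagonalizes n A lam V W -> (i < n)%nat -> (j < n)%nat ->
  Mpow n A m i j = Csum n (fun k => V i k * (Cpow (lam k) m * W k j))%Cx.
Proof.
  intros (HVW & _ & HA); revert i; induction m as [|m IH]; intros i Hi Hj; simpl.
  - rewrite <- (HVW i j Hi Hj); apply Csum_ext; intros; ring.
  - unfold Mmul.
    rewrite (Csum_ext n _ (fun l => Csum n (fun k => A i l * V l k * (Cpow (lam k) m * W k j)))%Cx)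
      by (intros l Hl; rewrite IH, <- Csum_scal by assumption; apply Csum_ext; intros; ring).
    rewrite Csum_swap; apply Csum_ext; intros k Hk.
    rewrite Csum_scal_r, HA by assumption; ring.
Qed.

Lemma Mexp_diag (n : nat) (A : Mat) (lam : nat -> C) (V W : Mat) (t : R) (i j : nat) :
  diagonalizes n A lam V W -> (i < n)%nat -> (j < n)%nat ->
  Mexp n A t i j = Csum n (fun k => V i k * (Cexp (lam k * RtoC t) * W k j))%Cx.
Proof.
  intros HD Hi Hj; apply Clim_unique.
  apply (Ccv_ext (fun K => Csum n (fun k => V i k *
    (Csum (S K) (fun m => RtoC (t ^ m / INR (fact m)) * Cpow (lam k) m) * W k j))%Cx)).
  - intros K.
    rewrite (Csum_ext (S K) (fun m => Cmul (RtoC _) (Mpow n A m i j)) (fun m => Csum n (fun k =>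
      RtoC (t ^ m / INR (fact m)) * (V i k * (Cpow (lam k) m * W k j))))%Cx)
      by (intros m _; rewrite (Mpow_diag n A lam V W) by assumption; now rewrite Csum_scal).
    rewrite Csum_swap; apply Csum_ext; intros k _.
    rewrite <- Csum_scal_r, <- Csum_scal; apply Csum_ext; intros; ring.
  - apply (Ccv_Csum n (fun k K => V i k *
      (Csum (S K) (fun m => RtoC (t ^ m / INR (fact m)) * Cpow (lam k) m) * W k j))%Cx).
    intros k _; apply Ccv_mul; [apply Ccv_const|].
    apply Ccv_mul; [apply Cexp_series|apply Ccv_const].
Qed.

(** * Limits at infinity and the stationary projection *)

Definition cvg_inf (f : R -> C) (l : C) : Prop :=
  forall eps, eps > 0 -> exists L0, forall L, L >= L0 -> Cnorm (Csub (f L) l) < eps.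

Lemma cvg_inf_unique (f : R -> C) (l l' : C) : cvg_inf f l -> cvg_inf f l' -> l = l'.
Proof.
  intros H H'; destruct (classic (l = l')) as [|Hne]; [assumption|exfalso].
  apply Csub_neq0, Cnorm_gt0 in Hne.
  destruct (H (Cnorm (l - l') / 2)) as [A HA]; [lra|].
  destruct (H' (Cnorm (l - l') / 2)) as [A' HA']; [lra|].
  specialize (HA (Rmax A A') (Rle_ge _ _ (Rmax_l A A'))).
  specialize (HA' (Rmax A A') (Rle_ge _ _ (Rmax_r A A'))).
  set (u := f (Rmax A A')) in *.
  generalize (Cnorm_add (u - l') (- (u - l))); rewrite Cnorm_opp.
  replace ((u - l') + - (u - l))%Cx with (l - l')%Cx by ring; lra.
Qed.

Lemma cvg_inf_add (f g : R -> C) (l m : C) :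
  cvg_inf f l -> cvg_inf g m -> cvg_inf (fun L => f L + g L)%Cx (l + m)%Cx.
Proof.
  intros Hf Hg eps He.
  destruct (Hf (eps / 2)) as [A HA]; [lra|].
  destruct (Hg (eps / 2)) as [B HB]; [lra|].
  exists (Rmax A B); intros L HL.
  specialize (HA L ltac:(generalize (Rmax_l A B); lra)).
  specialize (HB L ltac:(generalize (Rmax_r A B); lra)).
  replace (f L + g L - (l + m))%Cx with ((f L - l) + (g L - m))%Cx by ring.
  generalize (Cnorm_add (f L - l) (g L - m)); lra.
Qed.

Lemma cvg_inf_const (l : C) : cvg_inf (fun _ => l) l.
Proof.
  intros eps He; exists 0; intros L _.
  replace (l - l)%Cx with C0 by ring; rewrite Cnorm_C0; lra.
Qed.

Lemma cvg_inf_Csum (n : nat) (f : nat -> R -> C) (l : nat -> C) :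
  (forall k, (k < n)%nat -> cvg_inf (f k) (l k)) ->
  cvg_inf (fun L => Csum n (fun k => f k L)) (Csum n l).
Proof.
  induction n as [|n IH]; intros H; simpl; [apply cvg_inf_const|].
  apply cvg_inf_add; auto.
Qed.

Lemma cvg_inf_ext (f g : R -> C) (l : C) :
  (forall L, f L = g L) -> cvg_inf f l -> cvg_inf g l.
Proof. intros H; replace g with f; [easy|]; now apply functional_extensionality. Qed.

Lemma cvg_inf_Cexp (c z : C) :
  re z < 0 -> cvg_inf (fun L => c * Cexp (z * RtoC L))%Cx C0.
Proof.
  intros Hz eps He; set (q := eps / (Cnorm c + 1)).
  assert (Hc := Cnorm_ge0 c).
  assert (Hq : 0 < q) by (apply Rdiv_lt_0_compat; lra).
  (* As [re z] is negative, the modulus of the exponential is at most [q] from here on. The [+ 1] in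
     [q] allows [c] to be zero. *)
  exists (ln q / re z); intros L HL.
  replace (c * Cexp (z * RtoC L) - C0)%Cx with (c * Cexp (z * RtoC L))%Cx by ring.
  rewrite Cnorm_mul, Cnorm_Cexp; simpl.
  assert (Hexp : exp (re z * L - im z * 0) <= q).
  { rewrite <- (exp_ln q) by assumption; apply Rnot_lt_le; intros H; apply exp_lt_inv in H.
    assert (re z * L <= re z * (ln q / re z)) by nra.
    replace (re z * (ln q / re z)) with (ln q) in * by (field; lra); lra. }
  apply Rle_lt_trans with (Cnorm c * q); [now apply Rmult_le_compat_l|].
  replace eps with ((Cnorm c + 1) * q) by (unfold q; field; lra); nra.
Qed.

(** All modes but the one with eigenvalue 0 decay, which leaves the rank-one projection onto the
    stationary state. *)
Lemma Mexp_inf_diag (n : nat) (A : Mat) (lam : nat -> C) (V W : Mat) (i j : nat) :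
  diagonalizes n A lam V W -> lam 0%nat = C0 ->
  (forall k, (1 <= k < n)%nat -> re (lam k) < 0) ->
  (i < n)%nat -> (j < n)%nat ->
  Mexp_inf n A i j = (V i 0%nat * W 0%nat j)%Cx.
Proof.
  intros HD H0 Hneg Hi Hj.
  assert (H : cvg_inf (fun L => Mexp n A L i j) (V i 0%nat * W 0%nat j)%Cx).
  { apply (cvg_inf_ext (fun L => Csum n (fun k => V i k * W k j * Cexp (lam k * RtoC L)))%Cx).
    - intros L; rewrite (Mexp_diag n A lam V W) by assumption.
      apply Csum_ext; intros; ring.
    - rewrite <- (Csum_unitv n 0 (fun k => V i k * W k j)%Cx) by lia.
      apply (cvg_inf_Csum n (fun k L => V i k * W k j * Cexp (lam k * RtoC L))%Cx).
      intros k Hk; unfold unitv; destruct (Nat.eqb_spec k 0) as [->|Hne].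
      + rewrite H0; apply (cvg_inf_ext (fun _ => V i 0%nat * W 0%nat j * C1)%Cx).
        * intros L; f_equal; apply C_ext; simpl; rewrite !Rmult_0_l, Rminus_0_r, ?Rplus_0_r, exp_0, ?cos_0, ?sin_0; ring.
        * apply cvg_inf_const.
      + replace (V i k * W k j * C0)%Cx with C0 by ring.
        apply cvg_inf_Cexp, Hneg; lia. }
  apply (cvg_inf_unique (fun L => Mexp n A L i j)); [|assumption].
  exact (epsilon_spec C_inhabited (cvg_inf (fun L => Mexp n A L i j)) (ex_intro _ _ H)).
Qed.

(** * Laplace transforms *)

Lemma is_RIntC_is_RInt (f : R -> C) (a b : R) (w : C) :
  is_RIntC f a b w <->
  is_RInt (fun t => re (f t)) a b (re w) /\ is_RInt (fun t => im (f t)) a b (im w).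
Proof.
  assert (H : forall (g : R -> R) v,
    (exists pr : Riemann_integrable g a b, RiemannInt pr = v) <-> is_RInt g a b v).
  { intros g v; split.
    - intros [pr <-]; apply ex_RInt_Reals_aux_1.
    - intros Hg.
      assert (pr : Riemann_integrable g a b) by (apply ex_RInt_Reals_0; now exists v).
      exists pr; rewrite <- RInt_Reals; now apply is_RInt_unique. }
  unfold is_RIntC; now rewrite !H.
Qed.

Lemma is_RIntC_add (f g : R -> C) (a b : R) (v w : C) :
  is_RIntC f a b v -> is_RIntC g a b w -> is_RIntC (fun t => f t + g t)%Cx a b (v + w)%Cx.
Proof.
  rewrite !is_RIntC_is_RInt; intros [Hr Hi] [Hr' Hi']; split.
  - exact (is_RInt_plus _ _ _ _ _ _ Hr Hr').
  - exact (is_RInt_plus _ _ _ _ _ _ Hi Hi').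
Qed.

Lemma is_RIntC_C0 (a b : R) : is_RIntC (fun _ => C0) a b C0.
Proof.
  apply is_RIntC_is_RInt; simpl.
  assert (H : is_RInt (fun _ : R => 0) a b 0).
  { generalize (is_RInt_const (V := R_NormedModule) a b 0).
    unfold scal; simpl; unfold mult; simpl; now rewrite Rmult_0_r. }
  now split.
Qed.

Lemma is_RIntC_Csum (n : nat) (f : nat -> R -> C) (a b : R) (w : nat -> C) :
  (forall k, (k < n)%nat -> is_RIntC (f k) a b (w k)) ->
  is_RIntC (fun t => Csum n (fun k => f k t)) a b (Csum n w).
Proof.
  induction n as [|n IH]; intros H; simpl; [apply is_RIntC_C0|].
  apply is_RIntC_add; auto.
Qed.

(** The factor [z] in the integrand makes [q * Cexp (z * RtoC t)] an antiderivative without any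
    division. *)
Lemma is_RIntC_Cexp (q z : C) (A : R) :
  is_RIntC (fun t => q * z * Cexp (z * RtoC t))%Cx 0 A (q * Cexp (z * RtoC A) - q)%Cx.
Proof.
  pose (e := fun t => mkC (exp (re z * t) * cos (im z * t)) (exp (re z * t) * sin (im z * t))).
  assert (He : forall t, Cexp (z * RtoC t) = e t).
  { intros t; unfold e, Cexp; simpl.
    replace (re z * t - im z * 0) with (re z * t) by ring.
    now replace (re z * 0 + im z * t) with (im z * t) by ring. }
  replace (fun t => q * z * Cexp (z * RtoC t))%Cx with (fun t => q * z * e t)%Cx
    by (apply functional_extensionality; intros t; now rewrite He).
  rewrite He.
  assert (He0 : e 0 = C1).
  { apply C_ext; simpl; rewrite !Rmult_0_r, exp_0, ?cos_0, ?sin_0; ring. }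
  replace (q * e A - q)%Cx with (q * e A - q * e 0)%Cx by (rewrite He0; ring).
  apply is_RIntC_is_RInt; split.
  - apply (is_RInt_derive (fun t => re (q * e t))).
    + intros t _; simpl; auto_derive; [exact I|ring].
    + intros t _; apply (ex_derive_continuous (fun t => re (q * z * e t))).
      simpl; auto_derive; exact I.
  - apply (is_RInt_derive (fun t => im (q * e t))).
    + intros t _; simpl; auto_derive; [exact I|ring].
    + intros t _; apply (ex_derive_continuous (fun t => im (q * z * e t))).
      simpl; auto_derive; exact I.
Qed.

Lemma improper_int_exp_sum (n : nat) (c z : nat -> C) :
  (forall k, (k < n)%nat -> re (z k) < 0) ->
  improper_int (fun t => Csum n (fun k => c k * Cexp (z k * RtoC t))%Cx)
    (Csum n (fun k => - (c k / z k))%Cx).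
Proof.
  intros Hz.
  assert (Hz0 : forall k, (k < n)%nat -> z k <> C0).
  { intros k Hk E; specialize (Hz k Hk); rewrite E in Hz; simpl in Hz; lra. }
  pose (F := fun A => Csum n (fun k => c k / z k * Cexp (z k * RtoC A) - c k / z k)%Cx).
  assert (HF : cvg_inf F (Csum n (fun k => - (c k / z k))%Cx)).
  { apply (cvg_inf_Csum n (fun k A => c k / z k * Cexp (z k * RtoC A) - c k / z k)%Cx).
    intros k Hk; replace (- (c k / z k))%Cx with (C0 + - (c k / z k))%Cx by ring.
    apply (cvg_inf_add (fun A => c k / z k * Cexp (z k * RtoC A))%Cx (fun _ => - (c k / z k))%Cx).
    - apply cvg_inf_Cexp; auto.
    - apply cvg_inf_const. }
  intros eps He; destruct (HF eps He) as [A0 HA0]; exists A0; intros A HA.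
  exists (F A); split; [|auto].
  apply (is_RIntC_Csum n (fun k t => c k * Cexp (z k * RtoC t))%Cx); intros k Hk.
  replace (fun t => c k * Cexp (z k * RtoC t))%Cx
    with (fun t => c k / z k * z k * Cexp (z k * RtoC t))%Cx; [apply is_RIntC_Cexp|].
  apply functional_extensionality; intros t; field; auto.
Qed.

Lemma improper_int_unique (f g : R -> C) (v w : C) :
  (forall t, 0 <= t -> f t = g t) -> improper_int f v -> improper_int g w -> v = w.
Proof.
  intros Hfg Hf Hg; destruct (classic (v = w)) as [|Hne]; [assumption|exfalso].
  apply Csub_neq0, Cnorm_gt0 in Hne.
  destruct (Hf (Cnorm (v - w) / 2)) as [A HA]; [lra|].
  destruct (Hg (Cnorm (v - w) / 2)) as [B HB]; [lra|].
  (* The maximum with 0 orients the interval, so that only times where [f] and [g] agree are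
     integrated over. *)
  set (L := Rmax 0 (Rmax A B)).
  assert (HL : 0 <= L) by apply Rmax_l.
  destruct (HA L) as (a & Ha & Hav).
  { generalize (Rmax_r 0 (Rmax A B)) (Rmax_l A B); unfold L; lra. }
  destruct (HB L) as (b & Hb & Hbw).
  { generalize (Rmax_r 0 (Rmax A B)) (Rmax_r A B); unfold L; lra. }
  assert (E : a = b).
  { apply is_RIntC_is_RInt in Ha; apply is_RIntC_is_RInt in Hb.
    destruct Ha as [Har Hai], Hb as [Hbr Hbi].
    apply C_ext.
    - rewrite <- (is_RInt_unique _ _ _ _ Har), <- (is_RInt_unique _ _ _ _ Hbr).
      apply RInt_ext; intros t; rewrite Rmin_left by assumption; intros Ht; rewrite Hfg; lra.
    - rewrite <- (is_RInt_unique _ _ _ _ Hai), <- (is_RInt_unique _ _ _ _ Hbi).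
      apply RInt_ext; intros t; rewrite Rmin_left by assumption; intros Ht; rewrite Hfg; lra. }
  subst b.
  generalize (Cnorm_add (a - w) (- (a - v))); rewrite Cnorm_opp.
  replace ((a - w) + - (a - v))%Cx with (v - w)%Cx by ring; lra.
Qed.

(** Turns equal correlators into equal transforms, and identifies the fraction [P / D] of [has_pole]
    with the explicitly computed transform. *)
Lemma LapRel_unique (g g' : list R -> C) (ss : list C) (v v' : C) :
  (forall ts, length ts = length ss -> (forall t, In t ts -> 0 <= t) -> g ts = g' ts) ->
  LapRel g ss v -> LapRel g' ss v' -> v = v'.
Proof.
  revert g g' v v'; induction ss as [|s ss IH]; intros g g' v v' Hg; simpl.
  - intros -> ->; apply Hg; [reflexivity|intros t []].
  - intros (h & Hh & Hv) (h' & Hh' & Hv').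
    refine (improper_int_unique _ _ v v' _ Hv Hv'); intros t Ht; f_equal.
    apply (IH (fun ts => g (t :: ts)) (fun ts => g' (t :: ts))); [|now apply Hh|now apply Hh'].
    intros ts Hlen Hts; apply Hg; [simpl; congruence|].
    intros u [<-|Hu]; auto.
Qed.

(** * Correlation functions in the eigenbasis of the Liouvillian *)

Definition Mapply (n : nat) (A : Mat) (x : nat -> C) : nat -> C :=
  fun i => Csum n (fun k => A i k * x k)%Cx.

Lemma Mapply_Mmul (n : nat) (A B : Mat) (x : nat -> C) :
  Mapply n (Mmul n A B) x = Mapply n A (Mapply n B x).
Proof.
  apply functional_extensionality; intros i; unfold Mapply, Mmul.
  rewrite (Csum_ext n (fun k => _) (fun k => Csum n (fun l => A i l * B l k * x k))%Cx)
    by (intros k _; now rewrite Csum_scal_r).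
  rewrite Csum_swap; apply Csum_ext; intros l _.
  rewrite <- Csum_scal; apply Csum_ext; intros; ring.
Qed.

Lemma Mapply_ext (n : nat) (A : Mat) (x y : nat -> C) :
  (forall k, (k < n)%nat -> x k = y k) -> Mapply n A x = Mapply n A y.
Proof.
  intros H; apply functional_extensionality; intros i.
  apply Csum_ext; intros k Hk; now rewrite H.
Qed.

Lemma Mapply_inverse (n : nat) (A B : Mat) (x : nat -> C) (i : nat) :
  (forall j, (j < n)%nat -> Csum n (fun k => A i k * B k j)%Cx = Mid i j) ->
  (i < n)%nat -> Mapply n A (Mapply n B x) i = x i.
Proof.
  intros H Hi; rewrite <- Mapply_Mmul; unfold Mapply, Mmul.
  rewrite <- (Csum_Mid_l n i x Hi); apply Csum_ext; intros k Hk; now rewrite H.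
Qed.

Lemma Mapply_lincomb (n p : nat) (A : Mat) (c : nat -> C) (y : nat -> nat -> C) :
  Mapply n A (fun i => Csum p (fun k => c k * y k i)%Cx) =
  fun i => Csum p (fun k => c k * Mapply n A (y k) i)%Cx.
Proof.
  apply functional_extensionality; intros i; unfold Mapply.
  rewrite (Csum_ext n _ (fun l => Csum p (fun k => c k * (A i l * y k l)))%Cx)
    by (intros l _; rewrite <- Csum_scal; apply Csum_ext; intros; ring).
  rewrite Csum_swap; apply Csum_ext; intros k _; now rewrite Csum_scal.
Qed.

Lemma Mapply_unitv (n : nat) (A : Mat) (k i : nat) :
  (k < n)%nat -> Mapply n A (unitv k) i = A i k.
Proof. intros Hk; exact (Csum_unitv n k (fun l => A i l) Hk). Qed.

Section SpectralForm.
Context (n : nat) (lam : nat -> C) {J : Type} (m : J -> Mat).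

(** The correlator in eigenbasis coordinates, with the state as accumulator: the first letter acts
    first, propagators are diagonal, and the final component 0 is the pairing with the left
    eigenvector of eigenvalue 0. *)
Fixpoint time_form (js : list J) (ts : list R) (x : nat -> C) : C :=
  match js, ts with
  | j :: ((_ :: _) as js'), t :: ts' =>
      time_form js' ts' (fun k => Cexp (lam k * RtoC t) * Mapply n (m j) x k)%Cx
  | j :: _, _ => Mapply n (m j) x 0%nat
  | [], _ => x 0%nat
  end.

(** The same recursion after integrating each propagator: the integral of [exp (lam k t - s t)] over
    [t >= 0] is [1 / (s - lam k)]. *)
Fixpoint laplace_form (js : list J) (ss : list C) (x : nat -> C) : C :=
  match js, ss with
  | j :: ((_ :: _) as js'), s :: ss' =>
      laplace_form js' ss' (fun k => Mapply n (m j) x k / (s - lam k))%Cx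
  | j :: _, _ => Mapply n (m j) x 0%nat
  | [], _ => x 0%nat
  end.

(** The right part of a split word: each of its letters is followed by a propagator, so each
    consumes a variable, and the whole state is kept. *)
Fixpoint laplace_state (js : list J) (ss : list C) (x : nat -> C) : nat -> C :=
  match js, ss with
  | j :: js', s :: ss' =>
      laplace_state js' ss' (fun k => Mapply n (m j) x k / (s - lam k))%Cx
  | _, _ => x
  end.

Lemma laplace_form_lincomb (p : nat) (c : nat -> C) (js : list J) (ss : list C)
    (y : nat -> nat -> C) :
  laplace_form js ss (fun i => Csum p (fun k => c k * y k i)%Cx) =
  Csum p (fun k => c k * laplace_form js ss (y k))%Cx.
Proof.
  revert ss y; induction js as [|j [|j' js] IH]; intros ss y.
  - reflexivity.
  - simpl; now rewrite Mapply_lincomb.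
  - destruct ss as [|s ss].
    + simpl; now rewrite Mapply_lincomb.
    + change (laplace_form (j :: j' :: js) (s :: ss)) with (fun x =>
        laplace_form (j' :: js) ss (fun k => Mapply n (m j) x k / (s - lam k))%Cx); cbv beta.
      rewrite <- (IH ss (fun k i => Mapply n (m j) (y k) i / (s - lam i))%Cx).
      f_equal; apply functional_extensionality; intros i; rewrite Mapply_lincomb.
      unfold Cdiv; rewrite <- Csum_scal_r; apply Csum_ext; intros; ring.
Qed.

Lemma laplace_form_ext (js : list J) (ss : list C) (x y : nat -> C) :
  (0 < n)%nat -> (forall k, (k < n)%nat -> x k = y k) ->
  laplace_form js ss x = laplace_form js ss y.
Proof.
  intros Hn H; destruct js as [|j [|j' js]]; simpl; [now apply H| |];
    rewrite (Mapply_ext n (m j) x y H); reflexivity.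
Qed.

(** The values on the basis vectors form the row vector by which the remaining letters act: the left
    part of a split word. *)
Lemma laplace_form_expand (js : list J) (ss : list C) (x : nat -> C) :
  (0 < n)%nat ->
  laplace_form js ss x = Csum n (fun k => x k * laplace_form js ss (unitv k))%Cx.
Proof.
  intros Hn; rewrite <- laplace_form_lincomb; apply laplace_form_ext; [assumption|].
  intros i Hi; rewrite <- (Csum_unitv n i x Hi); apply Csum_ext; intros k _.
  unfold unitv; now rewrite Nat.eqb_sym.
Qed.

(** With [jL] nonempty, even the last letter of [jR] is followed by a propagator, so [sR] has as
    many variables as [jR] has letters. *)
Lemma laplace_form_app (jR jL : list J) (sR sL : list C) (x : nat -> C) :
  jL <> [] -> length sR = length jR ->
  laplace_form (jR ++ jL) (sR ++ sL) x = laplace_form jL sL (laplace_state jR sR x).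
Proof.
  intros HL; revert sR x; induction jR as [|j jR IH]; intros [|s sR] x Hlen;
    try discriminate; [reflexivity|].
  simpl laplace_state; rewrite <- IH by (simpl in Hlen; congruence).
  simpl; destruct (jR ++ jL) as [|j' js] eqn:E; [|reflexivity].
  apply app_eq_nil in E; tauto.
Qed.

Lemma laplace_form_cons (j : J) (jL : list J) (z : C) (sL : list C) (x : nat -> C) :
  (0 < n)%nat -> jL <> [] ->
  laplace_form (j :: jL) (z :: sL) x =
  Csum n (fun k => Mapply n (m j) x k * laplace_form jL sL (unitv k) / (z - lam k))%Cx.
Proof.
  intros Hn HL; destruct jL as [|j' jL]; [contradiction|].
  change (laplace_form (j :: j' :: jL) (z :: sL) x) with
    (laplace_form (j' :: jL) sL (fun k => Mapply n (m j) x k / (z - lam k))%Cx).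
  rewrite laplace_form_expand by assumption.
  apply Csum_ext; intros k _; unfold Cdiv; ring.
Qed.

(** In [z] alone this is a partial fraction whose coefficients, products of a right and a left part,
    do not depend on [z]. *)
Lemma laplace_form_split (j : J) (jR jL : list J) (z : C) (sR sL : list C) (x : nat -> C) :
  (0 < n)%nat -> jL <> [] -> length sR = length jR ->
  laplace_form (jR ++ j :: jL) (sR ++ z :: sL) x =
  Csum n (fun k => Mapply n (m j) (laplace_state jR sR x) k
                   * laplace_form jL sL (unitv k) / (z - lam k))%Cx.
Proof.
  intros Hn HL Hlen; rewrite laplace_form_app by (assumption || discriminate).
  now apply laplace_form_cons.
Qed.

(** The first time variable belongs to the outermost integral. The inner transform comes from the
    induction hypothesis at the propagated state; by linearity it is an exponential sum in [t], and
    the damping factor moves its exponents to [lam k - s], with negative real part. *)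
Lemma LapRel_time_form (js : list J) (ss : list C) (x : nat -> C) :
  (0 < n)%nat -> (forall k, (k < n)%nat -> re (lam k) <= 0) ->
  length js = S (length ss) -> (forall s, In s ss -> re s > 0) ->
  LapRel (fun ts => time_form js ts x) ss (laplace_form js ss x).
Proof.
  intros Hn Hre; revert js x; induction ss as [|s ss IH]; intros js x Hlen Hss.
  - destruct js as [|j [|j' js]]; try discriminate; reflexivity.
  - destruct js as [|j [|j' js]]; try discriminate.
    pose (h := fun t => laplace_form (j' :: js) ss
      (fun k => Cexp (lam k * RtoC t) * Mapply n (m j) x k)%Cx).
    exists h; split.
    + intros t _; apply (IH (j' :: js) (fun k => Cexp (lam k * RtoC t) * Mapply n (m j) x k)%Cx).
      * simpl in *; lia.
      * intros u Hu; apply Hss; now right.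
    + assert (Hs : re s > 0) by (apply Hss; now left).
      rewrite laplace_form_cons by (assumption || discriminate).
      pose (c := fun k => (Mapply n (m j) x k * laplace_form (j' :: js) ss (unitv k))%Cx).
      rewrite (Csum_ext n _ (fun k => - (c k / (lam k - s)))%Cx).
      2: { intros k Hk; specialize (Hre k Hk); unfold c; field; split; apply Csub_neq0.
           - intros E; rewrite E in Hre; lra.
           - intros E; rewrite <- E in Hre; lra. }
      replace (fun t => Cexp (- (s * RtoC t)) * h t)%Cx
        with (fun t => Csum n (fun k => c k * Cexp ((lam k - s) * RtoC t)))%Cx.
      * apply improper_int_exp_sum; intros k Hk; specialize (Hre k Hk); simpl; lra.
      * apply functional_extensionality; intros t; unfold h.
        rewrite (laplace_form_expand (j' :: js)) by assumption.
        rewrite <- Csum_scal; apply Csum_ext; intros k _; unfold c.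
        replace ((lam k - s) * RtoC t)%Cx with (- (s * RtoC t) + lam k * RtoC t)%Cx by ring.
        rewrite Cexp_add; ring.
Qed.

End SpectralForm.

Definition eigen_coeff (d : nat) {J : Type} (kind : J -> Kind) (Rm V W : Mat) (j : J) : Mat :=
  Mmul (d * d) W (Mmul (d * d) (Mop d Rm (kind j)) V).

(** [chain] keeps its first letter at the right end, so peeling it off updates the vector acted on;
    hence the induction runs over all [x]. *)
Lemma chain_time_form (d : nat) (J : Type) (kind : J -> Kind) (Qm Rm : Mat)
    (lam : nat -> C) (V W : Mat) (js : list J) (ts : list R) (x : nat -> C) :
  (0 < d * d)%nat -> diagonalizes (d * d) (Liouv d Qm Rm) lam V W ->
  Mapply (d * d) W (Mapply (d * d) (chain d J kind Qm Rm js ts) (Mapply (d * d) V x)) 0%nat =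
  time_form (d * d) lam (eigen_coeff d kind Rm V W) js ts x.
Proof.
  intros Hn HD.
  assert (Hcoef : forall j y, Mapply (d * d) (eigen_coeff d kind Rm V W j) y =
    Mapply (d * d) W (Mapply (d * d) (Mop d Rm (kind j)) (Mapply (d * d) V y)))
    by (intros; unfold eigen_coeff; now rewrite !Mapply_Mmul).
  revert ts x; induction js as [|j [|j' js] IH]; intros ts x.
  - transitivity (Mapply (d * d) W (Mapply (d * d) V x) 0%nat).
    + apply (f_equal (fun g => g 0%nat)), Mapply_ext; intros k Hk; now apply Csum_Mid_l.
    + apply Mapply_inverse; [|assumption]; intros j Hj; now apply (proj1 (proj2 HD)).
  - simpl; now rewrite Hcoef.
  - destruct ts as [|t ts]; [simpl; now rewrite Hcoef|].
    change (chain d J kind Qm Rm (j :: j' :: js) (t :: ts)) with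
      (Mmul (d * d) (chain d J kind Qm Rm (j' :: js) ts)
        (Mmul (d * d) (Mexp (d * d) (Liouv d Qm Rm) t) (Mop d Rm (kind j)))).
    change (time_form (d * d) lam ?m (j :: j' :: js) (t :: ts) x) with
      (time_form (d * d) lam m (j' :: js) ts
        (fun k => Cexp (lam k * RtoC t) * Mapply (d * d) (m j) x k)%Cx).
    rewrite <- IH, !Mapply_Mmul.
    apply (f_equal (fun g => Mapply (d * d) W g 0%nat)), Mapply_ext; intros i Hi.
    rewrite Hcoef; set (y := Mapply (d * d) (Mop d Rm (kind j)) (Mapply (d * d) V x)).
    unfold Mapply at 1 2.
    rewrite (Csum_ext (d * d) _ (fun l => Csum (d * d) (fun k =>
      V i k * Cexp (lam k * RtoC t) * (W k l * y l)))%Cx).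
    2: { intros l Hl; rewrite (Mexp_diag _ _ lam V W), <- Csum_scal_r by assumption.
         apply Csum_ext; intros; ring. }
    rewrite Csum_swap; apply Csum_ext; intros k _.
    rewrite Csum_scal; unfold Mapply; ring.
Qed.

(** The trace against the rank-one stationary projection is a single matrix element; [unitv 0] is
    the stationary state in eigenbasis coordinates. *)
Lemma corr_time_form (d : nat) (J : Type) (kind : J -> Kind) (Qm Rm : Mat)
    (lam : nat -> C) (V W : Mat) (js : list J) (ts : list R) :
  (0 < d * d)%nat -> diagonalizes (d * d) (Liouv d Qm Rm) lam V W ->
  lam 0%nat = C0 -> (forall k, (1 <= k < d * d)%nat -> re (lam k) < 0) ->
  corr d J kind Qm Rm js ts =
  time_form (d * d) lam (eigen_coeff d kind Rm V W) js ts (unitv 0).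
Proof.
  intros Hn HD H0 Hneg; rewrite <- (chain_time_form d J kind Qm) by assumption.
  unfold corr, Mtrace, Mapply at 1; apply Csum_ext; intros i Hi.
  unfold Mmul, Mapply at 1; rewrite <- Csum_scal; apply Csum_ext; intros l Hl.
  rewrite (Mexp_inf_diag _ _ lam V W) by assumption.
  rewrite Mapply_unitv by assumption; ring.
Qed.

(** * Residues of a word and the diagonal change of eigenbasis *)

Lemma replace_nth_app {A : Type} (l r : list A) (x y : A) :
  replace_nth (l ++ x :: r) (length l) y = l ++ y :: r.
Proof. induction l as [|a l IH]; simpl; [reflexivity|now rewrite IH]. Qed.

Lemma split_at {A : Type} (l : list A) (i : nat) :
  (i < length l)%nat -> exists l1 x l2, l = l1 ++ x :: l2 /\ length l1 = i.
Proof.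
  intros Hi; destruct (nth_error l i) as [x|] eqn:E.
  - apply nth_error_split in E; destruct E as (l1 & l2 & -> & Hl); now exists l1, x, l2.
  - apply nth_error_None in E; lia.
Qed.

(** Were the residue zero on the slice supplied by [has_pole], the partial fraction would be regular
    at [lam k] and [P / D] bounded near it. The slice, hence [sR] and [sL], depends on [k]. *)
Lemma has_pole_residue (d : nat) (J : Type) (kind : J -> Kind) (Qm Rm : Mat)
    (lam : nat -> C) (V W : Mat) (jR jL : list J) (j : J) (k : nat) :
  (0 < d * d)%nat -> diagonalizes (d * d) (Liouv d Qm Rm) lam V W ->
  lam 0%nat = C0 -> (forall i, (1 <= i < d * d)%nat -> re (lam i) < 0) ->
  (forall i i', (i < d * d)%nat -> (i' < d * d)%nat -> lam i = lam i' -> i = i') ->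
  jL <> [] -> (k < d * d)%nat ->
  has_pole d J kind Qm Rm (jR ++ j :: jL) (length jR) (lam k) ->
  let m := eigen_coeff d kind Rm V W in
  exists sR sL, length sR = length jR /\ length jL = S (length sL) /\
    (forall s, In s sR -> re s > 0) /\ (forall s, In s sL -> re s > 0) /\
    (Mapply (d * d) (m j) (laplace_state (d * d) lam m jR sR (unitv 0)) k
     * laplace_form (d * d) lam m jL sL (unitv k))%Cx <> C0.
Proof.
  intros Hn HD H0 Hneg Hinj HjL Hk (s & Hlen & Hpos & P & D & Hrat & Hunb) m.
  assert (Hre : forall i, (i < d * d)%nat -> re (lam i) <= 0).
  { intros [|i] Hi; [rewrite H0; simpl; lra|apply Rlt_le, Hneg; lia]. }
  rewrite length_app in Hlen; simpl in Hlen.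
  assert (HjL' : (0 < length jL)%nat) by (destruct jL; [contradiction|simpl; lia]).
  destruct (split_at s (length jR)) as (sR & s0 & sL & -> & HsR); [lia|].
  rewrite length_app in Hlen; simpl in Hlen.
  assert (HposR : forall s, In s sR -> re s > 0) by (intros u Hu; apply Hpos, in_or_app; now left).
  assert (HposL : forall s, In s sL -> re s > 0)
    by (intros u Hu; apply Hpos, in_or_app; right; now right).
  exists sR, sL; split; [assumption|split; [lia|split; [assumption|split; [assumption|]]]].
  intros E.
  set (f := fun z => laplace_form (d * d) lam m (jR ++ j :: jL) (sR ++ z :: sL) (unitv 0)).
  destruct (regular_at_bounded (lam k) f P D) as (B & delta & Hdelta & HB).
  - apply (regular_at_ext (lam k) (fun z => Csum (d * d) (fun i =>
      Mapply (d * d) (m j) (laplace_state (d * d) lam m jR sR (unitv 0)) i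
      * laplace_form (d * d) lam m jL sL (unitv i) / (z - lam i)))%Cx).
    + intros z _; unfold f; now rewrite laplace_form_split.
    + apply (partial_fractions_regular (d * d) lam (fun i =>
        Mapply (d * d) (m j) (laplace_state (d * d) lam m jR sR (unitv 0)) i
        * laplace_form (d * d) lam m jL sL (unitv i))%Cx); [assumption|].
      intros i Hi Ei; apply Hinj in Ei; [now subst i|assumption|assumption].
  - intros z Hz; destruct (Hrat z Hz) as [HD' HL]; split; [assumption|].
    rewrite <- HsR, replace_nth_app in HL.
    refine (LapRel_unique _ _ _ _ _ _ (LapRel_time_form (d * d) lam m _ _ (unitv 0) Hn Hre _ _) HL).
    + intros ts _ _; symmetry; now apply corr_time_form.
    + rewrite !length_app; simpl; lia.
    + intros u Hu; apply in_app_or in Hu; destruct Hu as [Hu|[<-|Hu]]; auto.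
  - destruct (Hunb B delta Hdelta) as (z & [_ Hz] & HDz & Hgt).
    specialize (HB z Hz HDz); lra.
Qed.

(* [a] is the diagonal change of eigenbasis relating the two families [m], [m']. *)
Lemma time_form_gauge (n : nat) (lam : nat -> C) (J : Type) (m m' : J -> Mat)
    (a : nat -> C) (js : list J) (ts : list R) (x y : nat -> C) :
  (0 < n)%nat ->
  (forall j k l, (k < n)%nat -> (l < n)%nat -> (m' j k l * a l = a k * m j k l)%Cx) ->
  (forall k, (k < n)%nat -> y k = (a k * x k)%Cx) ->
  time_form n lam m' js ts y = (a 0%nat * time_form n lam m js ts x)%Cx.
Proof.
  intros Hn Hm.
  assert (HM : forall j x y, (forall k, (k < n)%nat -> y k = (a k * x k)%Cx) ->
    forall k, (k < n)%nat -> Mapply n (m' j) y k = (a k * Mapply n (m j) x k)%Cx).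
  { clear x y; intros j x y Hxy k Hk; unfold Mapply; rewrite <- Csum_scal.
    apply Csum_ext; intros l Hl; rewrite Hxy by assumption.
    transitivity (m' j k l * a l * x l)%Cx; [ring|]; rewrite Hm by assumption; ring. }
  revert ts x y; induction js as [|j [|j' js] IH]; intros ts x y Hxy.
  - now apply Hxy.
  - now apply HM.
  - destruct ts as [|t ts]; [now apply HM|].
    apply (IH ts (fun k => Cexp (lam k * RtoC t) * Mapply n (m j) x k)%Cx
      (fun k => Cexp (lam k * RtoC t) * Mapply n (m' j) y k)%Cx).
    intros k Hk; rewrite (HM j x y Hxy k Hk); ring.
Qed.

(** The bound [length jR + length jL + 2] is the length of the word with one letter inserted after
    [j0]. *)
Lemma residues_gauge (n : nat) (lam : nat -> C) (J : Type) (m m' : J -> Mat)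
    (jR jL : list J) (j0 : J) :
  (0 < n)%nat ->
  (forall k, (k < n)%nat -> re (lam k) <= 0) ->
  (forall k l, (k < n)%nat -> (l < n)%nat -> lam k = lam l -> k = l) ->
  jL <> [] ->
  (forall js ss, length js = S (length ss) ->
     (1 <= length js <= length jR + length jL + 2)%nat ->
     (forall s, In s ss -> re s > 0) ->
     laplace_form n lam m js ss (unitv 0) = laplace_form n lam m' js ss (unitv 0)) ->
  (forall k, (k < n)%nat ->
     exists sR sL, length sR = length jR /\ length jL = S (length sL) /\
       (forall s, In s sR -> re s > 0) /\ (forall s, In s sL -> re s > 0) /\
       (Mapply n (m j0) (laplace_state n lam m jR sR (unitv 0)) k
        * laplace_form n lam m jL sL (unitv k))%Cx <> C0) ->
  exists a : nat -> C, (forall k, (k < n)%nat -> a k <> C0) /\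
    forall j k l, (k < n)%nat -> (l < n)%nat -> (m' j k l * a l = a k * m j k l)%Cx.
Proof.
  intros Hn Hre Hinj HjL Heq Hpole.
  assert (Hres : forall c c' : nat -> C,
    (forall z, re z > 0 -> Csum n (fun k => c k / (z - lam k))%Cx
       = Csum n (fun k => c' k / (z - lam k))%Cx) -> forall k, (k < n)%nat -> c k = c' k).
  { intros c c' H k Hk.
    assert (E : (c k - c' k)%Cx = C0).
    { apply (partial_fractions_residue n lam (fun k => c k - c' k)%Cx (fun _ => C0) k); try assumption.
      - apply regular_at_const.
      - intros z Hz.
        transitivity (Csum n (fun i => c i / (z - lam i)) - Csum n (fun i => c' i / (z - lam i)))%Cx.
        + rewrite <- Csum_sub; apply Csum_ext; intros; unfold Cdiv; ring.
        + rewrite H by assumption; ring. }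
    replace (c k) with ((c k - c' k) + c' k)%Cx by ring; rewrite E; ring. }
  pose (U := fun sR k => Mapply n (m j0) (laplace_state n lam m jR sR (unitv 0)) k).
  pose (U' := fun sR k => Mapply n (m' j0) (laplace_state n lam m' jR sR (unitv 0)) k).
  pose (X := fun sL k => laplace_form n lam m jL sL (unitv k)).
  pose (X' := fun sL k => laplace_form n lam m' jL sL (unitv k)).
  (* One slice per eigenvalue, selected by choice. *)
  assert (Hsl : exists sl : nat -> list C * list C, forall k, (k < n)%nat ->
    length (fst (sl k)) = length jR /\ length jL = S (length (snd (sl k))) /\
    (forall s, In s (fst (sl k)) -> re s > 0) /\ (forall s, In s (snd (sl k)) -> re s > 0) /\
    (U (fst (sl k)) k * X (snd (sl k)) k)%Cx <> C0).
  { apply (choice (fun k (p : list C * list C) => (k < n)%nat ->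
      length (fst p) = length jR /\ length jL = S (length (snd p)) /\
      (forall s, In s (fst p) -> re s > 0) /\ (forall s, In s (snd p) -> re s > 0) /\
      (U (fst p) k * X (snd p) k)%Cx <> C0)); intros k.
    destruct (classic (k < n)%nat) as [Hk|Hk].
    - destruct (Hpole k Hk) as (sR & sL & H); now exists (sR, sL).
    - exists ([], []); intros; contradiction. }
  destruct Hsl as [sl Hsl].
  pose (u := fun k => U (fst (sl k)) k); pose (u' := fun k => U' (fst (sl k)) k).
  pose (w := fun k => X (snd (sl k)) k); pose (w' := fun k => X' (snd (sl k)) k).
  assert (HjL0 : (0 < length jL)%nat) by (destruct jL; [contradiction|simpl; lia]).
  assert (Hdiag : forall k, (k < n)%nat -> (u k * w k = u' k * w' k)%Cx).
  { intros k Hk; destruct (Hsl k Hk) as (HlR & HlL & HpR & HpL & _).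
    apply (Hres (fun i => U (fst (sl k)) i * X (snd (sl k)) i)%Cx
      (fun i => U' (fst (sl k)) i * X' (snd (sl k)) i)%Cx); [|assumption].
    intros z Hz; unfold U, U', X, X'.
    rewrite <- !laplace_form_split by assumption; apply Heq.
    - rewrite !length_app; simpl; lia.
    - rewrite length_app; simpl; lia.
    - intros v Hv; apply in_app_or in Hv; destruct Hv as [Hv|[<-|Hv]]; auto. }
  (* The right variables come from the slice of [k], the left ones from that of [l]. Residues are
     compared twice: in the variable after [j0] at [lam k], then in the variable after [j] at
     [lam l]. *)
  assert (Hins : forall j k l, (k < n)%nat -> (l < n)%nat ->
    (u k * (m j l k * w l) = u' k * (m' j l k * w' l))%Cx).
  { intros j k l Hk Hl; destruct (Hsl k Hk) as (HlR & _ & HpR & _).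
    destruct (Hsl l Hl) as (_ & HlL & _ & HpL & _).
    apply (Hres (fun i => u k * (m j i k * X (snd (sl l)) i))%Cx
      (fun i => u' k * (m' j i k * X' (snd (sl l)) i))%Cx); [|assumption].
    intros z' Hz'.
    transitivity (u k * laplace_form n lam m (j :: jL) (z' :: snd (sl l)) (unitv k))%Cx.
    { rewrite laplace_form_cons, <- Csum_scal by assumption; apply Csum_ext; intros i _.
      rewrite Mapply_unitv by assumption; unfold X, Cdiv; ring. }
    transitivity (u' k * laplace_form n lam m' (j :: jL) (z' :: snd (sl l)) (unitv k))%Cx.
    2: { rewrite laplace_form_cons, <- Csum_scal by assumption; apply Csum_ext; intros i _.
         rewrite Mapply_unitv by assumption; unfold X', Cdiv; ring. }
    apply (Hres
      (fun i => U (fst (sl k)) i * laplace_form n lam m (j :: jL) (z' :: snd (sl l)) (unitv i))%Cx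
      (fun i => U' (fst (sl k)) i * laplace_form n lam m' (j :: jL) (z' :: snd (sl l)) (unitv i))%Cx);
      [|assumption].
    intros z Hz; unfold U, U'.
    rewrite <- !laplace_form_split by (assumption || discriminate); apply Heq.
    - rewrite !length_app; simpl; lia.
    - rewrite length_app; simpl; lia.
    - intros v Hv; apply in_app_or in Hv; destruct Hv as [Hv|[<-|[<-|Hv]]]; auto. }
  assert (Hnz : forall k, (k < n)%nat -> u k <> C0 /\ w k <> C0 /\ u' k <> C0 /\ w' k <> C0).
  { intros k Hk; destruct (Hsl k Hk) as (_ & _ & _ & _ & H).
    change ((u k * w k)%Cx <> C0) in H; specialize (Hdiag k Hk).
    repeat split; intros E; apply H; [|rewrite E; ring|rewrite Hdiag, E; ring|rewrite Hdiag, E; ring].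
    rewrite E; ring. }
  exists (fun k => u' k / u k)%Cx; split.
  - intros k Hk E; destruct (Hnz k Hk) as (H1 & _ & H2 & _); apply H2.
    replace (u' k) with (u' k / u k * u k)%Cx by (field; assumption); rewrite E; ring.
  - intros j l k Hl Hk.
    destruct (Hnz k Hk) as (H1 & _), (Hnz l Hl) as (H2 & _ & _ & H3).
    (* Multiplied by this nonzero factor, both sides become [u k * m j l k * w l]: the left one by
       [Hins], the right one by [Hdiag] at [l]. *)
    apply (Cmul_cancel_l (u k * w' l)).
    + intros E; apply Cmul_integral in E; tauto.
    + transitivity (u' k * (m' j l k * w' l))%Cx; [field; assumption|].
      rewrite <- Hins by assumption.
      transitivity (u k * m j l k * (u' l * w' l) / u l)%Cx; [|field; assumption].
      rewrite <- Hdiag by assumption; field; assumption.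
Qed.

Theorem mainTheorem4 (d : nat) (J : Type) (kind : J -> Kind)
  (Qm Rm Qm' Rm' : Mat) (p : nat) :
  (1 <= d)%nat ->
  (exists l : list J, forall j, In j l) ->
  generic d Qm Rm -> generic d Qm' Rm' ->
  (exists p1, pnumber d J kind Qm Rm p1 /\ (p1 <= p)%nat) ->
  (exists p2, pnumber d J kind Qm' Rm' p2 /\ (p2 <= p)%nat) ->
  (forall (l : nat) (js : list J) (ts : list R),
      (1 <= l <= 2 * p - 1)%nat -> length js = l -> length ts = (l - 1)%nat ->
      (forall t, In t ts -> 0 <= t) ->
      corr d J kind Qm Rm js ts = corr d J kind Qm' Rm' js ts) ->
  forall (N : nat) (js : list J) (ts : list R),
    (1 <= N)%nat -> length js = N -> length ts = (N - 1)%nat ->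
    (forall t, In t ts -> 0 <= t) ->
    corr d J kind Qm Rm js ts = corr d J kind Qm' Rm' js ts.
Proof.
  intros Hd _ (lam & Heig & Hinj & H0 & Hneg) (lam' & Heig' & Hinj' & H0' & Hneg')
    (p1 & [(N0 & js0 & i & HN0 & Hjs0 & Hi & Hpole) _] & Hp1) _ Hcorr N js ts _ _ _ _.
  assert (Hn : (0 < d * d)%nat) by nia.
  destruct (distinct_eigenvalues_diagonalize _ _ lam Heig Hinj) as (V & W & HD).
  destruct (split_at js0 i) as (jR & j0 & jL & -> & HjR); [lia|].
  subst i; rewrite length_app in Hjs0; simpl in Hjs0.
  assert (HjL : jL <> []) by (intros ->; simpl in *; lia).
  assert (Hre : forall k, (k < d * d)%nat -> re (lam k) <= 0).
  { intros [|k] Hk; [rewrite H0; simpl; lra|apply Rlt_le, Hneg; lia]. }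
  set (m := eigen_coeff d kind Rm V W).
  assert (Hslice := fun k Hk => has_pole_residue d J kind Qm Rm lam V W jR jL j0 k
    Hn HD H0 Hneg Hinj HjL Hk (Hpole _ (Heig k Hk))); fold m in Hslice; cbv zeta in Hslice.
  (* Stated for any diagonalisation of the second Liouvillian: it is applied with [lam'] to compare
     the spectra, then with [lam]. *)
  assert (Hlap : forall mu V' W', diagonalizes (d * d) (Liouv d Qm' Rm') mu V' W' ->
    mu 0%nat = C0 -> (forall k, (1 <= k < d * d)%nat -> re (mu k) < 0) ->
    forall js ss, length js = S (length ss) ->
    (1 <= length js <= length jR + length jL + 2)%nat ->
    (forall s, In s ss -> re s > 0) ->
    laplace_form (d * d) lam m js ss (unitv 0) =
    laplace_form (d * d) mu (eigen_coeff d kind Rm' V' W') js ss (unitv 0)).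
  { intros mu V' W' HD' Hmu0 Hmu js' ss Hlen Hle Hss.
    refine (LapRel_unique _ _ ss _ _ _
      (LapRel_time_form (d * d) lam m js' ss (unitv 0) Hn Hre Hlen Hss)
      (LapRel_time_form (d * d) mu _ js' ss (unitv 0) Hn _ Hlen Hss)).
    - intros ts' Hts' Hpos.
      unfold m; rewrite <- (corr_time_form d J kind Qm Rm), <- (corr_time_form d J kind Qm' Rm') by assumption.
      (* The length is at most [N0 + 1 <= p + 1], and [N0 >= 2] since [jL] is nonempty, so it is at
         most [2 * p - 1]. *)
      apply (Hcorr (length js')); try assumption; lia.
    - intros [|k] Hk; [rewrite Hmu0; simpl; lra|apply Rlt_le, Hmu; lia]. }
  assert (Hre' : forall k, (k < d * d)%nat -> re (lam' k) <= 0).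
  { intros [|k] Hk; [rewrite H0'; simpl; lra|apply Rlt_le, Hneg'; lia]. }
  (* If [lam k] were missing from the second spectrum, the second transform of the pole word would
     be regular there, forcing a zero residue on the first side. *)
  assert (Hspec : forall k, (k < d * d)%nat -> eigenvalue (d * d) (Liouv d Qm' Rm') (lam k)).
  { intros k Hk.
    destruct (classic (exists k', (k' < d * d)%nat /\ lam' k' = lam k)) as [(k' & Hk' & <-)|Hno];
      [now apply Heig'|exfalso].
    destruct (distinct_eigenvalues_diagonalize _ _ lam' Heig' Hinj') as (V' & W' & HD').
    set (m' := eigen_coeff d kind Rm' V' W').
    destruct (Hslice k Hk) as (sR & sL & HlR & HlL & HpR & HpL & Hne); apply Hne.
    apply (partial_fractions_residue (d * d) lam
      (fun i => Mapply (d * d) (m j0) (laplace_state (d * d) lam m jR sR (unitv 0)) i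
        * laplace_form (d * d) lam m jL sL (unitv i))%Cx
      (fun z => Csum (d * d) (fun i =>
        Mapply (d * d) (m' j0) (laplace_state (d * d) lam' m' jR sR (unitv 0)) i
        * laplace_form (d * d) lam' m' jL sL (unitv i) / (z - lam' i)))%Cx k); try assumption.
    - apply (partial_fractions_regular (d * d) lam' (fun i =>
        Mapply (d * d) (m' j0) (laplace_state (d * d) lam' m' jR sR (unitv 0)) i
        * laplace_form (d * d) lam' m' jL sL (unitv i))%Cx); [assumption|].
      intros k' Hk' E; exfalso; apply Hno; now exists k'.
    - intros z Hz; rewrite <- !laplace_form_split by assumption.
      apply Hlap; try assumption.
      + rewrite !length_app; simpl; lia.
      + rewrite length_app; simpl; lia.
      + intros v Hv; apply in_app_or in Hv; destruct Hv as [Hv|[<-|Hv]]; auto. }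
  (* Diagonalising with [lam] itself lists the eigenvectors in the same order as for the first
     Liouvillian, so no permutation enters the change of basis. *)
  destruct (distinct_eigenvalues_diagonalize _ _ lam Hspec Hinj) as (V' & W' & HD').
  set (m' := eigen_coeff d kind Rm' V' W').
  destruct (residues_gauge (d * d) lam J m m' jR jL j0) as (a & Ha & Hgauge); try assumption.
  { now apply Hlap. }
  rewrite (corr_time_form d J kind Qm Rm lam V W) by assumption.
  rewrite (corr_time_form d J kind Qm' Rm' lam V' W') by assumption.
  fold m m'; symmetry.
  assert (Ha0 := Ha 0%nat Hn).
  (* Dividing by [a 0] keeps the conjugacy, fixes the initial state [unitv 0] and makes the overall
     factor 1. *)
  rewrite (time_form_gauge (d * d) lam J m m' (fun k => a k / a 0%nat)%Cx js ts (unitv 0)); try assumption.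
  - field; assumption.
  - intros j k l Hk Hl.
    transitivity (m' j k l * a l / a 0%nat)%Cx; [field; assumption|].
    rewrite Hgauge by assumption; field; assumption.
  - intros k _; unfold unitv; destruct (Nat.eqb_spec k 0) as [->|]; field; assumption.
Qed.
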